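(* Let $\lambda>0$ and $\nu\in(0,1]$. The solution $p_k^{\nu}(t)$, for $k=0,1,\dots$ and $t\ge 0$, of the Cauchy problem $$\frac{d^{\nu}p_k}{dt^{\nu}}=-\lambda\,(p_k-p_{k-1}),\qquad k\ge 0,$$ with $p_{-1}(t)=0$ and initial conditions $p_k(0)=1$ if $k=0$ and $p_k(0)=0$ if $k\ge 1$, is given by $$p_k^{\nu}(t)=(\lambda t^{\nu})^{k}\,E_{\nu,\nu k+1}^{k+1}(-\lambda t^{\nu}),\qquad k\ge 0,\ t>0.$$
   Context: The fractional derivative is in the sense of Caputo: for $m\in\mathbb{N}$, $$\frac{d^{\nu}}{dt^{\nu}}u(t)=\begin{cases}\dfrac{1}{\Gamma(m-\nu)}\displaystyle\int_0^t\frac{1}{(t-s)^{1+\nu-m}}\frac{d^m}{ds^m}u(s)\,ds, & m-1<\nu<m,\\[2mm] \dfrac{d^m}{dt^m}u(t), & \nu=m.\end{cases}$$ The generalized Mittag-Leffler function is $$E_{\alpha,\beta}^{\gamma}(z)=\sum_{r=0}^{\infty}\frac{(\gamma)_r\,z^r}{r!\,\Gamma(\alpha r+\beta)},\qquad \alpha,\beta,\gamma\in\mathbb{C},\ \mathrm{Re}(\alpha),\mathrm{Re}(\beta),\mathrm{Re}(\gamma)>0,$$ where $(\gamma)_r=\gamma(\gamma+1)\cdots(\gamma+r-1)$ for $r\ge 1$ and $(\gamma)_0=1$. *)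

(* Defs.v *)
From HB Require Import structures.
From mathcomp Require Import all_boot all_order all_algebra.
From mathcomp Require Import all_classical all_reals all_analysis.

Set Implicit Arguments.
Unset Strict Implicit.
Unset Printing Implicit Defensive.

Import Order.TTheory GRing.Theory Num.Theory.
Import numFieldNormedType.Exports.

Local Open Scope classical_set_scope.
Local Open Scope ring_scope.

Section special_functions.
Context {R : realType}.

(* Euler's integral, the value of the Gamma function for x > 0. *)
Definition Gamma (x : R) : R :=
  \int[lebesgue_measure]_(s in `[0, +oo[) (s `^ (x - 1) * expR (- s)).

Definition pochhammer (c : R) (r : nat) : R := \prod_(i < r) (c + i%:R).

(* The three-parameter Mittag-Leffler function E_{a,b}^c(z), for real
   a, b, c > 0 and real z, where the series converges absolutely. *)
Definition mittag_leffler (a b c z : R) : R :=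
  limn (series (fun r : nat =>
    pochhammer c r * z ^+ r / (r`!%:R * Gamma (a * r%:R + b)))).

End special_functions.

Section caputo.
Context {R : realType}.

(* The integer m with m - 1 < nu <= m, for nu > 0. *)
Definition caputo_order (nu : R) : nat := `|Num.ceil nu|%N.

Definition caputo_integrand (nu : R) (u : R -> R) (t s : R) : R :=
  derive1n (caputo_order nu) u s / (t - s) `^ (1 + nu - (caputo_order nu)%:R).

Definition caputo (nu : R) (u : R -> R) (t : R) : R :=
  let m := caputo_order nu in
  if nu == m%:R then derive1n m u t
  else (Gamma (m%:R - nu))^-1 *
    \int[lebesgue_measure]_(s in `[0, t]) caputo_integrand nu u t s.

(* [caputo] is total: this says that the derivatives and the integral in its
   definition exist at every t > 0.  No derivative is required at 0, since
   solutions of fractional equations typically behave there like t `^ nu. *)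
Definition caputo_derivable (nu : R) (u : R -> R) : Prop :=
  (forall (i : nat) (s : R), (i < caputo_order nu)%N -> 0 < s ->
     derivable (derive1n i u) s 1) /\
  (nu != (caputo_order nu)%:R -> forall t : R, 0 < t ->
     lebesgue_measure.-integrable `[0, t] (EFin \o caputo_integrand nu u t)).

End caputo.

Section fractional_Poisson.
Context {R : realType}.

(* p_{k-1}, with p_{-1} = 0. *)
Definition shifted (p : nat -> R -> R) (k : nat) : R -> R :=
  if k is j.+1 then p j else fun=> 0.

(* Only the values on [0, +oo[ matter.  The equation is imposed for t > 0;
   continuity at 0 ties the initial value to the solution. *)
Definition fractional_Poisson_solution
    (lambda nu : R) (p : nat -> R -> R) : Prop :=
  forall k : nat,
  [/\ caputo_derivable nu (p k),
      forall t : R, 0 < t ->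
        caputo nu (p k) t = - lambda * (p k t - shifted p k t),
      p k x @[x --> 0^'+] --> p k 0
    & p k 0 = if k == 0%N then 1 else 0].

End fractional_Poisson.

(* Main.v *)
From HB Require Import structures.
Require Import Defs.
From mathcomp Require Import all_boot all_order all_algebra.
From mathcomp Require Import all_classical all_reals all_analysis.
From mathcomp Require Import measurable_realfun ring lra.

(* Existence: expanding the Mittag-Leffler functions, the claimed p_k is a power
   series sum_j a_(k, j) t^(nu j) / Gamma(nu j + 1), with
   a_(k, j) = C(j, k) (-1)^(j - k) lambda^j.  By Euler's Beta integral the Caputo
   derivative acts on such a series by shifting the sequence a_(k, .), so the
   equation is Pascal's rule.

   Uniqueness: the difference w of two solutions satisfies D^nu w = - lambda w,
   w(0+) = 0.  As w' is integrable near 0, w is the integral of w' (w' need not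
   be continuous, so this uses the fundamental theorem of calculus for everywhere
   differentiable functions with integrable derivative); convolving the equation
   with t^(nu - 1) then gives w = - lambda I^nu w, where I^nu is the
   Riemann-Liouville integral.  For C large, this operator halves bounds of the
   form |w(t)| <= M exp(C t), hence w = 0. *)

Set Implicit Arguments.
Unset Strict Implicit.
Unset Printing Implicit Defensive.
Import Order.TTheory GRing.Theory Num.Theory.
Import numFieldNormedType.Exports.
Local Open Scope classical_set_scope.
Local Open Scope ring_scope.

(** * Power kernels, Gamma and Beta *)

(** The regularity hypotheses shape the uniqueness half: they give differentiability at each s > 0
    and integrability of (t - s)^(- nu) w'(s), but neither continuity of w' nor a bound on it near
    0. Hence w' can enter only as an integrable function. Convolution with t^(nu - 1) inverts the
    Caputo derivative because the exponents nu and 1 - nu of the two kernels add up to 1, so that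
    the kernels compose to a constant, B(nu, 1 - nu) = Gamma nu * Gamma (1 - nu), which cancels the
    normalising factors. The halving comes from the weight: over the whole line, convolving exp (C
    t) with t^(nu - 1) / Gamma nu gives C^(- nu) exp (C t), and C is chosen with C^nu = 2 lambda.
    This C serves on every ]0, T], so no subdivision into short intervals occurs. The case nu = 1
    stands apart, since the kernel t^(- nu) is then not integrable at 0; an integrating factor
    replaces it. Both halves meet in an induction on k: once p_(k-1) is known, it is a source term
    that cancels in the difference of two solutions. *)

Section change_of_variables.
Context {R : realType}.
Local Notation mu := (@lebesgue_measure R).

(** Lebesgue measure equals c times its image under x -> c x + d, because the two agree on half-open
    intervals. Stated for nonnegative functions in the extended reals, so that it applies before any
    integral is known to be finite. *)
Lemma ge0_integralT_affine (f : R -> \bar R) (c d : R) : 0 < c ->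
  measurable_fun [set: R] f -> (forall x, 0 <= f x)%E ->
  (\int[mu]_x f x = c%:E * \int[mu]_x f (c * x + d)%R)%E.
Proof.
move=> c0 mf f0.
pose phi : measurableTypeR R -> measurableTypeR R := fun x => c * x + d.
have mphi : measurable_fun [set: measurableTypeR R] phi.
  by apply: measurable_funD => //; apply: measurable_funM.
pose nu : {measure set (measurableTypeR R) -> \bar R} :=
  measure_function_pushforward__canonical__measure_function_Measure mu mphi.
have cge0 : 0 <= c by rewrite ltW.
transitivity (\int[mscale (NngNum cge0) nu]_y f y)%E; last first.
  rewrite ge0_integral_mscale//; congr (_ * _)%E.
  by rewrite /nu/= ge0_integral_pushforward// preimage_setT.
apply: eq_measure_integral => A mA _.
apply: lebesgue_measure_unique => // _ [[x y] _ <-].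
transitivity (c%:E * mu (phi @^-1` `]x, y]))%E; last by [].
have -> : phi @^-1` `]x, y] = `](x - d) / c, (y - d) / c]%classic.
  apply/seteqP; split => z /=; rewrite !in_itv/= /phi.
    by rewrite ltr_pdivrMr// ler_pdivlMr// mulrC ltrBlDr lerBrDr.
  by rewrite ltr_pdivrMr// ler_pdivlMr// mulrC ltrBlDr lerBrDr.
rewrite !lebesgue_measure_itv/= !lte_fin ltr_pM2r ?invr_gt0// ltrD2r.
case: ifP => _; last by rewrite mule0.
by rewrite -!EFinB -EFinM; congr EFin; field; rewrite gt_eqF.
Qed.

Lemma ge0_integralT_opp (f : R -> \bar R) :
  measurable_fun [set: R] f -> (forall x, 0 <= f x)%E ->
  (\int[mu]_x f x = \int[mu]_x f (- x)%R)%E.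
Proof.
move=> mf f0.
pose phi : measurableTypeR R -> measurableTypeR R := fun x => - x.
have mphi : measurable_fun [set: measurableTypeR R] phi by exact: measurableT_comp.
pose nu : {measure set (measurableTypeR R) -> \bar R} :=
  measure_function_pushforward__canonical__measure_function_Measure mu mphi.
transitivity (\int[nu]_y f y)%E; last first.
  by rewrite /nu/= ge0_integral_pushforward// preimage_setT.
by apply: eq_measure_integral => A mA _; exact: esym (lebesgue_measureN mA).
Qed.

End change_of_variables.

Section power_kernel.
Context {R : realType}.
Local Notation mu := (@lebesgue_measure R).

(* Extended by 0 to [s <= 0], so that Riemann-Liouville integrals are convolutions
   over the whole line. *)
Definition powker (a s : R) : R := if 0 < s then s `^ (a - 1) else 0.

Lemma powker_ge0 (a s : R) : 0 <= powker a s.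
Proof. by rewrite /powker; case: ifP => // _; exact: powR_ge0. Qed.

Lemma powker_gt0E (a s : R) : 0 < s -> powker a s = s `^ (a - 1).
Proof. by rewrite /powker => ->. Qed.

Lemma powker_le0E (a s : R) : s <= 0 -> powker a s = 0.
Proof. by rewrite /powker ltNge => ->. Qed.

Lemma measurable_powker (a : R) : measurable_fun [set: R] (powker a).
Proof.
rewrite (_ : powker a = (fun s => s `^ (a - 1)) \_ `]0, +oo[); last first.
  apply/funext => s; rewrite patchE /powker; case: ifPn => s0.
    by rewrite mem_set//= in_itv/= s0.
  by rewrite memNset//= in_itv/= andbT; exact/negP.
apply/(measurable_restrictT _ _).1 => //.
by apply: measurable_funTS; exact: measurable_powR.
Qed.

Lemma derivable1_cvg (f : R -> R) (x : R) :
  derivable f x 1 -> f y @[y --> x] --> f x.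
Proof. by move=> /derivable1_diffP; exact: differentiable_continuous. Qed.

Lemma derivable_continuous_powR (p a b : R) : 0 < a ->
  {within `[a, b], continuous (fun s : R => s `^ p)}.
Proof.
move=> a0; apply: derivable_within_continuous => x.
rewrite in_itv/= => /andP[ax _]; apply: derivable_powR.
by rewrite in_itv/= andbT (lt_le_trans a0).
Qed.

Lemma integral_powR (x a : R) : 0 < x -> 0 < a < 1 ->
  (\int[mu]_(s in `[a, 1%R]) (s `^ (x - 1))%:E = ((1 - a `^ x) / x)%:E)%E.
Proof.
move=> x0 /andP[a0 a1].
rewrite (@continuous_FTC2 _ _ (fun s => x^-1 * s `^ x))//.
- by rewrite powR1 -EFinB; congr EFin; ring.
- exact: derivable_continuous_powR.
- have cF (y : R) : 0 < y -> derivable (fun s : R => x^-1 * s `^ x) y 1.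
    by move=> y0; apply: derivableM => //; apply: derivable_powR; rewrite in_itv/= y0.
  split.
  + by move=> y; rewrite in_itv/= => /andP[ay _]; apply: cF; exact: lt_trans ay.
  + by apply: cvg_at_right_filter; apply: derivable1_cvg; exact: cF.
  + by apply: cvg_at_left_filter; apply: derivable1_cvg; exact: cF.
- move=> y; rewrite in_itv/= => /andP[ay _].
  have y0 := lt_trans a0 ay.
  rewrite derive1E deriveZ//=; last by apply: derivable_powR; rewrite in_itv/= y0.
  rewrite -derive1E powR_derive1 ?in_itv/= ?y0//.
  by rewrite scalerA mulVf ?gt_eqF// scale1r.
Qed.

(** This is B(1, x) = 1 / x; the factor [powker 1 (1 - s)] is the indicator of s < 1. Since s^(x -
    1) may be singular at 0, the integral is the monotone limit of those over [1 / (n + 2), 1]. *)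
Lemma integral_powker01 (x : R) : 0 < x ->
  (\int[mu]_s (powker 1 (1 - s) * powker x s)%:E = (x^-1)%:E)%E.
Proof.
move=> x0.
have nV (n : nat) : 0 < (n.+2%:R^-1 : R) < 1.
  by rewrite invr_gt0 ltr0n/= invf_lt1 ?ltr0n// ltr1n.
pose f (s : R) := (powker 1 (1 - s) * powker x s)%:E.
have fE s : 0 < s < 1 -> f s = (s `^ (x - 1))%:E.
  move=> /andP[s0 s1].
  by rewrite /f !powker_gt0E ?subr_gt0// subrr powRr0 mul1r.
have mf : measurable_fun [set: R] f.
  apply/measurable_EFinP; apply: measurable_funM; last exact: measurable_powker.
  by apply: measurableT_comp; [exact: measurable_powker|exact: measurable_funB].
have f0 s : (0 <= f s)%E by rewrite lee_fin mulr_ge0// powker_ge0.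
pose g n := f \_ `[n.+2%:R^-1, 1%R].
have gint n : (\int[mu]_s g n s = ((1 - n.+2%:R^-1 `^ x) / x)%:E)%E.
  rewrite -integral_powR//.
  transitivity (\int[mu]_(s in `[n.+2%:R^-1%R, 1%R]) f s)%E.
    by rewrite [RHS]integral_mkcond.
  rewrite -!integral_itv_bndo_bndc; last 2 first.
  - apply: measurable_funTS; apply/measurable_EFinP; exact: measurable_powR.
  - exact: measurable_funTS.
  apply: eq_integral => s; rewrite inE/= in_itv/= => /andP[ns s1].
  by rewrite fE// s1 andbT (lt_le_trans _ ns)//; case/andP: (nV n).
have gf s : g n s @[n --> \oo] --> f s.
  apply: cvg_near_cst.
  have [s0|s0] := leP s 0.
    near=> n; rewrite /g patchE; case: ifP => // _.
    by rewrite /f (powker_le0E _ s0) mulr0.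
  have [s1|s1] := leP 1 s.
    near=> n; rewrite /g patchE; case: ifP => // _.
    by rewrite /f powker_le0E ?mul0r// subr_le0.
  near=> n; rewrite /g patchE mem_set//= in_itv/= (ltW s1) andbT ltW//.
  rewrite -[ltRHS]invrK ltf_pV2 ?posrE ?invr_gt0//.
  apply: lt_trans (_ : n%:R < _); last by rewrite ltr_nat.
  by near: n; exact: (cvgryPgt _).1 cvgr_idn _.
have gcvg : (\int[mu]_s g n s)%E @[n --> \oo] --> (\int[mu]_s f s)%E.
  have -> : f = (fun s => limn (g ^~ s)).
    by apply/funext => s; apply/esym/cvg_lim => //; exact: gf.
  apply: cvg_monotone_convergence => //.
  - move=> n; apply/(measurable_restrictT _ _).1 => //; exact: measurable_funTS.
  - by move=> n s _; exact: erestrict_ge0.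
  - move=> s _ m n mn; apply: restrict_lee => //.
    move=> r /=; rewrite !in_itv/= => /andP[mr ->]; rewrite andbT.
    by rewrite (le_trans _ mr)// lef_pV2 ?posrE ?ltr0n// ler_nat !ltnS.
rewrite (_ : (fun n => _) = fun n => ((1 - n.+2%:R^-1 `^ x) / x)%:E) in gcvg;
  last by apply/funext => n; exact: gint.
apply: (cvg_unique _ gcvg) => //.
apply: cvg_EFin; first exact: nearW.
rewrite -[X in _ --> X](mul1r x^-1); apply: cvgMr_tmp.
rewrite -[X in _ --> X](subr0 1); apply: cvgB; first exact: cvg_cst.
apply: (cvg_comp _ _ _ (powR_cvg0 x0)) => P [e /= e0 eP].
near=> n; apply: eP => /=; last by case/andP: (nV n).
rewrite sub0r normrN gtr0_norm; last by case/andP: (nV n).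
rewrite -[ltRHS]invrK ltf_pV2 ?posrE ?invr_gt0//.
apply: lt_trans (_ : n%:R < _); last by rewrite ltr_nat.
by near: n; exact: (cvgryPgt _).1 cvgr_idn _.
Unshelve. all: by end_near. Qed.
End power_kernel.

Section gamma.
Context {R : realType}.
Local Notation mu := (@lebesgue_measure R).

Lemma measurable_expRN : measurable_fun [set: R] (fun s : R => expR (- s)).
Proof. by apply: measurableT_comp => //; exact: measurableT_comp. Qed.

Lemma measurable_gamma_integrand (x : R) :
  measurable_fun [set: R] (fun s : R => (powker x s * expR (- s))%:E).
Proof.
apply/measurable_EFinP; apply: measurable_funM; first exact: measurable_powker.
exact: measurable_expRN.
Qed.

Lemma gamma_integrand_ge0 (x s : R) : (0 <= (powker x s * expR (- s))%:E)%E.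
Proof. by rewrite lee_fin mulr_ge0 ?powker_ge0 ?expR_ge0. Qed.

(** The bound y <= exp y at y = s / (2 x), raised to the power x; the rate 1/2 leaves room against
    exp (- s). *)
Lemma powR_le_expR (x s : R) : 0 < x -> 0 <= s ->
  s `^ x <= (2 * x) `^ x * expR (s / 2).
Proof.
move=> x0 s0.
have x20 : 0 < 2 * x by rewrite mulr_gt0.
have h : s <= 2 * x * expR (s / (2 * x)).
  rewrite -ler_pdivrMl// mulrC; apply: le_trans (expR_ge1Dx _).
  by rewrite lerDr.
apply: (@le_trans _ _ ((2 * x * expR (s / (2 * x))) `^ x)).
  apply: ge0_ler_powR => //; rewrite ?nnegrE//; first exact: ltW.
  by rewrite mulr_ge0 ?expR_ge0// ltW.
rewrite powRM ?expR_ge0 ?(ltW x20)// [X in _ * X <= _]/powR gt_eqF ?expR_gt0//.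
rewrite expRK (_ : x * (s / (2 * x)) = s / 2)//.
by field; rewrite gt_eqF.
Qed.

(** The content is finiteness: [Gamma] is the [fine] part of an integral and would be 0 if that
    integral diverged. The integrand is dominated by s^(x - 1) below 1 and by a multiple of an
    exponential density above. *)
Lemma EFin_Gamma (x : R) : 0 < x ->
  (\int[mu]_s (powker x s * expR (- s))%:E = (Gamma x)%:E)%E.
Proof.
move=> x0.
have -> : Gamma x = fine (\int[mu]_s (powker x s * expR (- s))%:E)%E.
  rewrite /Gamma /Rintegral -integral_itv_obnd_cbnd; last first.
    apply: measurable_funTS; apply/measurable_EFinP; apply: measurable_funM.
      exact: measurable_powR.
    exact: measurable_expRN.
  rewrite integral_mkcond; congr fine; apply: eq_integral => s _.
  rewrite patchE; case: ifPn => [|/negP] s0.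
    by move: s0; rewrite inE/= in_itv/= andbT => s0; rewrite powker_gt0E.
  rewrite powker_le0E ?mul0r// leNgt; apply/negP => s1; apply: s0.
  by rewrite inE/= in_itv/= s1.
rewrite fineK// ge0_fin_numE; last first.
  by apply: integral_ge0 => s _; exact: gamma_integrand_ge0.
(* The leading 2 cancels the normalisation 1/2 of the exponential density of rate 1/2. *)
pose K := 2 * (2 * x) `^ x.
have K0 : 0 <= K by rewrite mulr_ge0// powR_ge0.
pose h1 (s : R) := (powker 1 (1 - s) * powker x s)%:E.
pose h2 (s : R) := (K%:E * (exponential_pdf 2^-1 s)%:E)%E.
have mh1 : measurable_fun [set: R] h1.
  apply/measurable_EFinP; apply: measurable_funM; last exact: measurable_powker.
  by apply: measurableT_comp; [exact: measurable_powker|exact: measurable_funB].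
have mh2 : measurable_fun [set: R] h2.
  by apply: measurable_funeM; apply/measurable_EFinP; exact: measurable_exponential_pdf.
have h10 s : (0 <= h1 s)%E by rewrite lee_fin mulr_ge0// powker_ge0.
have h20 s : (0 <= h2 s)%E.
  by rewrite mule_ge0// lee_fin exponential_pdf_ge0// invr_ge0.
apply: (@le_lt_trans _ _ (\int[mu]_s (h1 s + h2 s))%E).
  apply: ge0_le_integral => //.
  - by move=> s _; exact: gamma_integrand_ge0.
  - exact: measurable_gamma_integrand.
  - exact: emeasurable_funD.
  move=> s _; have [s0|s0] := leP s 0.
    by rewrite powker_le0E// mul0r adde_ge0.
  have [s1|s1] := ltP s 1.
    apply: (@le_trans _ _ (h1 s)); last exact: leeDl.
    rewrite lee_fin /h1 (powker_gt0E 1) ?subr_gt0// subrr powRr0 mul1r.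
    by rewrite ler_piMr ?powker_ge0// -expR0 ler_expR oppr_le0 ltW.
  apply: (@le_trans _ _ (h2 s)); last exact: leeDr.
  rewrite /h2 -EFinM lee_fin powker_gt0E// exponential_pdfE ?(ltW s0)//.
  apply: (@le_trans _ _ (s `^ x * expR (- s))).
    by rewrite ler_wpM2r ?expR_ge0// ler_powR// gerBl.
  apply: (@le_trans _ _ ((2 * x) `^ x * expR (s / 2) * expR (- s))).
    by rewrite ler_wpM2r ?expR_ge0// powR_le_expR// ltW.
  rewrite -mulrA -expRD /K (_ : s / 2 - s = - 2^-1 * s); last by field.
  by rewrite le_eqVlt; apply/orP; left; apply/eqP; field.
rewrite ge0_integralD// ge0_integralZl_EFin//.
- rewrite integral_exponential_pdf// mule1 lte_add_pinfty ?ltry//.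
  by rewrite integral_powker01// ltry.
- by move=> s _; rewrite lee_fin exponential_pdf_ge0// invr_ge0.
- by apply/measurable_EFinP; exact: measurable_exponential_pdf.
Qed.

Lemma Gamma_ge0 (x : R) : 0 <= Gamma x.
Proof.
apply: fine_ge0; apply: integral_ge0 => s _.
by rewrite lee_fin mulr_ge0 ?powR_ge0 ?expR_ge0.
Qed.

(** Only s >= A is kept, where s^(x - 1) >= A^(x - 1) and exp (- s) has integral exp (- A). As A is
    free, this already shows that Gamma outgrows every geometric sequence, in place of Stirling's
    formula. *)
Lemma Gamma_ge (x A : R) : 1 <= x -> 0 < A ->
  A `^ (x - 1) * expR (- A) <= Gamma x.
Proof.
move=> x1 A0; have x0 : 0 < x by rewrite (lt_le_trans ltr01).
have mexp : measurable_fun [set: R] (fun s => (exponential_pdf (1 : R) s)%:E).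
  by apply/measurable_EFinP; exact: measurable_exponential_pdf.
have pdf0 (s : R) : 0 <= exponential_pdf 1 s by exact: exponential_pdf_ge0.
rewrite -lee_fin -EFin_Gamma//.
apply: (@le_trans _ _ (\int[mu]_s ((A `^ (x - 1) * expR (- A))%:E *
    (exponential_pdf 1 (1 * s + - A))%:E))%E).
  rewrite ge0_integralZl_EFin//.
  - have := @ge0_integralT_affine _ (fun s => (exponential_pdf 1 s)%:E) 1 (- A) ltr01 mexp
      (fun s => pdf0 s).
    by rewrite integral_exponential_pdf// mul1e => <-; rewrite mule1.
  - by move=> s _; rewrite lee_fin.
  - apply/measurable_EFinP; apply: measurableT_comp => //.
      exact: measurable_exponential_pdf.
    by apply: measurable_funD => //; exact: measurable_funM.
  - by rewrite mulr_ge0 ?powR_ge0 ?expR_ge0.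
apply: ge0_le_integral => //.
- by move=> s _; rewrite -EFinM lee_fin mulr_ge0// mulr_ge0 ?powR_ge0 ?expR_ge0.
- apply: measurable_funeM; apply/measurable_EFinP; apply: measurableT_comp => //.
    exact: measurable_exponential_pdf.
  by apply: measurable_funD => //; exact: measurable_funM.
- exact: measurable_gamma_integrand.
move=> s _; rewrite -EFinM lee_fin mul1r.
have [sA|As] := ltP s A.
  by rewrite lt0_exponential_pdf ?subr_lt0// mulr0 mulr_ge0 ?powker_ge0 ?expR_ge0.
rewrite exponential_pdfE ?subr_ge0// mul1r -mulrA -expRD.
rewrite powker_gt0E ?(lt_le_trans A0)// (_ : - A + -1 * (s - A) = - s); last by ring.
by rewrite ler_wpM2r ?expR_ge0// ge0_ler_powR ?subr_ge0 ?nnegrE ?(ltW A0) ?(le_trans (ltW A0)).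
Qed.

Lemma powkerM (a t s : R) : 0 < t -> powker a (t * s) = t `^ (a - 1) * powker a s.
Proof.
move=> t0; rewrite /powker pmulr_rgt0//; case: ifP => s0; last by rewrite mulr0.
by rewrite powRM// ltW.
Qed.

Lemma measurable_powker_conv (a b t : R) :
  measurable_fun [set: R] (fun s => (powker a (t - s) * powker b s)%:E).
Proof.
apply/measurable_EFinP; apply: measurable_funM; last exact: measurable_powker.
by apply: measurableT_comp; [exact: measurable_powker|exact: measurable_funB].
Qed.

Lemma powker_conv_ge0 (a b t s : R) : (0 <= (powker a (t - s) * powker b s)%:E)%E.
Proof. by rewrite lee_fin mulr_ge0// powker_ge0. Qed.

(** Euler's Beta function B(a, b), left in the extended reals because its finiteness is only a
    consequence of [Gamma_unit_conv]. *)
Let unit_conv (a b : R) : \bar R :=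
  (\int[mu]_s (powker a (1 - s) * powker b s)%:E)%E.

Lemma powker_conv_scale (a b t : R) :
  (\int[mu]_s (powker a (t - s) * powker b s)%:E =
   (powker (a + b) t)%:E * unit_conv a b)%E.
Proof.
have [t0|t0] := leP t 0.
  rewrite (powker_le0E _ t0) mul0e integral0_eq// => s _.
  have [s0|s0] := leP s 0; first by rewrite (powker_le0E _ s0) mulr0.
  by rewrite powker_le0E ?mul0r// subr_le0 (le_trans t0)// ltW.
rewrite (@ge0_integralT_affine _ (fun s => (powker a (t - s) * powker b s)%:E) t 0 t0
  (measurable_powker_conv a b t) (powker_conv_ge0 a b t)).
transitivity (t%:E * ((t `^ (a - 1) * t `^ (b - 1))%:E * unit_conv a b))%E.
  congr (_ * _)%E; rewrite -ge0_integralZl_EFin; last first.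
  - by rewrite mulr_ge0 ?powR_ge0.
  - exact: measurable_powker_conv.
  - by move=> s _; exact: powker_conv_ge0.
  - exact: measurableT.
  apply: eq_integral => s _.
  by rewrite addr0 -{1}(mulr1 t) -mulrBr !powkerM// mulrACA EFinM.
rewrite muleA -EFinM; congr (_%:E * _)%E.
rewrite powker_gt0E// -powRD; last by rewrite (gt_eqF t0) implybT.
rewrite -{1}(powRr1 (ltW t0)) -powRD; last by rewrite (gt_eqF t0) implybT.
by congr (_ `^ _); ring.
Qed.

(** Tonelli for [F]: integrating in x first and writing exp (- x) = exp (- y) exp (- (x - y))
    separates the two Gamma integrals; integrating in y first gives the convolution x^(a + b - 1)
    B(a, b) against exp (- x). *)
Lemma Gamma_unit_conv (a b : R) : 0 < a -> 0 < b ->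
  ((Gamma a * Gamma b)%:E = (Gamma (a + b))%:E * unit_conv a b)%E.
Proof.
move=> a0 b0.
pose F (p : R * R) : \bar R :=
  (powker a (p.1 - p.2) * powker b p.2 * expR (- p.1))%:E.
have F0 p : (0 <= F p)%E by rewrite lee_fin !mulr_ge0 ?powker_ge0 ?expR_ge0.
have mF : measurable_fun setT F.
  apply/measurable_EFinP; apply: measurable_funM.
    apply: measurable_funM.
      by apply: measurableT_comp; [exact: measurable_powker|exact: measurable_funB].
    by apply: measurableT_comp; [exact: measurable_powker|].
  exact: (measurableT_comp measurable_expRN).
transitivity (\int[mu]_y \int[mu]_x F (x, y))%E.
  rewrite EFinM -[in LHS](EFin_Gamma b0) -ge0_integralZl_EFin; last first.
  - exact: Gamma_ge0.
  - exact: measurable_gamma_integrand.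
  - by move=> s _; exact: gamma_integrand_ge0.
  - exact: measurableT.
  apply: eq_integral => y _.
  pose h (x : R) := (powker a x * expR (- x))%:E.
  have hint : (\int[mu]_x h (1 * x + - y)%R = (Gamma a)%:E)%E.
    have := @ge0_integralT_affine _ h 1 (- y) ltr01 (measurable_gamma_integrand a)
      (gamma_integrand_ge0 a).
    by rewrite mul1e EFin_Gamma.
  rewrite -hint muleC -ge0_integralZl_EFin//.
  - apply: eq_integral => x _; rewrite /h /F/= mul1r -EFinM; congr EFin.
    have -> : - x = - y + - (x - y) by ring.
    by rewrite expRD; ring.
  - by move=> s _; exact: gamma_integrand_ge0.
  - apply: measurableT_comp; first exact: measurable_gamma_integrand.
    by apply: measurable_funD => //; exact: measurable_funM.
  - by rewrite mulr_ge0 ?powker_ge0 ?expR_ge0.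
transitivity (\int[mu]_x \int[mu]_y F (x, y))%E.
  exact: esym (@fubini_tonelli _ _ _ _ _ mu mu F mF F0).
rewrite -EFin_Gamma ?addr_gt0// muleC -ge0_integralZl//; last 3 first.
- exact: measurable_gamma_integrand.
- by move=> s _; exact: gamma_integrand_ge0.
- by apply: integral_ge0 => s _; exact: powker_conv_ge0.
apply: eq_integral => x _; rewrite EFinM muleA (muleC (unit_conv _ _)).
rewrite -powker_conv_scale muleC -ge0_integralZl_EFin ?expR_ge0//; last 2 first.
- by move=> s _; exact: powker_conv_ge0.
- exact: measurable_powker_conv.
by apply: eq_integral => y _; rewrite /F/= -EFinM mulrC.
Qed.

Lemma unit_conv_cst1 (x : R) : 0 < x -> unit_conv 1 x = (x^-1)%:E.
Proof. exact: integral_powker01. Qed.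

Lemma Gamma1 : Gamma (1 : R) = 1.
Proof.
have h := @integral_exponential_pdf R 1 ltr01.
transitivity (fine (\int[mu]_s (exponential_pdf 1 s)%:E)%E); last by rewrite h.
rewrite /Gamma /Rintegral; congr fine; rewrite [LHS]integral_mkcond; apply: eq_integral => s _.
rewrite /exponential_pdf !patchE; case: ifP => //= _.
by rewrite subrr powRr0 !mul1r mulN1r.
Qed.

(** Read off from B(1, x) = 1 / x instead of an integration by parts. *)
Lemma GammaD1 (x : R) : 0 < x -> Gamma (x + 1) = x * Gamma x.
Proof.
move=> x0; have := Gamma_unit_conv ltr01 x0.
rewrite Gamma1 mul1r unit_conv_cst1// -EFinM => -[->].
by rewrite mulrCA mulfV ?gt_eqF// mulr1 addrC.
Qed.

Lemma Gamma_gt0 (x : R) : 0 < x -> 0 < Gamma x.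
Proof.
(* [Gamma_ge] requires an argument of at least 1, hence the passage to x + 1. *)
move=> x0; rewrite -(pmulr_rgt0 _ x0) -GammaD1//.
apply: lt_le_trans (@Gamma_ge (x + 1) 1 _ ltr01); last by rewrite lerDr ltW.
by rewrite mulr_gt0 ?powR_gt0 ?expR_gt0.
Qed.

Lemma powker_conv (a b t : R) : 0 < a -> 0 < b ->
  (\int[mu]_s (powker a (t - s) * powker b s)%:E =
   (Gamma a * Gamma b / Gamma (a + b) * powker (a + b) t)%:E)%E.
Proof.
move=> a0 b0; have G0 := Gamma_gt0 (addr_gt0 a0 b0).
rewrite powker_conv_scale [RHS]EFinM muleC; congr (_ * _)%E.
have := congr1 (fun z => (Gamma (a + b))^-1%:E * z)%E (Gamma_unit_conv a0 b0).
by rewrite muleA -!EFinM mulVf ?gt_eqF// mul1e => <-; rewrite mulrC.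
Qed.

End gamma.

(** * The fundamental theorem of calculus for Lebesgue integrable derivatives *)

Section lebesgue_ftc.
Context {R : realType}.
Local Notation mu := (@lebesgue_measure R).

(** Real induction in which a step leads from y on the left of x to z on its right. This suits a
    derivative at x, which controls f z - f y only for pairs enclosing x. *)
Lemma straddle_induction (P : R -> Prop) (a b : R) : a <= b -> P a ->
  (forall x, a <= x <= b -> exists2 e, 0 < e &
    forall y z, x - e < y <= x -> x <= z < x + e -> a <= y -> z <= b ->
      P y -> P z) ->
  P b.
Proof.
move=> ab Pa step.
pose S := [set x | a <= x <= b /\ P x].
have Sa : S a by split=> //; rewrite lexx ab.
have ubS : ubound S b by move=> x [/andP[]].
have hS : has_sup S by split; [exists a|exists b].
have cle : sup S <= b by apply: ge_sup => //; exists a.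
have ale : a <= sup S by apply: ub_le_sup => //; exists b.
have [|e e0 He] := step (sup S); first by rewrite ale.
have [y Sy yc] := sup_adherent e0 hS.
have ys : y <= sup S by apply: ub_le_sup => //; exists b.
have [/andP[ay yb] Py] := Sy.
(* Either z = b, so that [P b] holds, or z is an element of S beyond [sup S]. *)
pose z := Num.min b (sup S + e / 2).
have e2 : 0 < e / 2 by rewrite divr_gt0.
have Pz : P z.
  apply: (He y) => //; last by rewrite ge_min lexx.
  - by rewrite yc.
  - by rewrite le_min cle lerDl (ltW e2)/= gt_min ltrD2l gtr_pMr// invf_lt1// ltr1n orbT.
have zs : z <= sup S.
  apply: ub_le_sup; first by exists b.
  split=> //; rewrite ge_min lexx/= le_min ab/=.
  by rewrite (le_trans ale)// lerDl ltW.
move: zs Pz; rewrite /z; have [//|h] := leP b (sup S + e / 2).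
by rewrite gerDl leNgt e2.
Qed.

(* A form of the Vitali-Caratheodory theorem: the last clause stands for the
   lower semicontinuity of [v] together with [g < v]. *)
Lemma vitali_caratheodory (g : R -> R) (a b eps : R) : a <= b -> 0 < eps ->
  (forall x, 0 <= g x) -> measurable_fun `[a, b] g ->
  exists v : R -> \bar R, [/\ measurable_fun `[a, b] v,
    (forall x, 0 <= v x)%E,
    (\int[mu]_(x in `[a, b]) v x <= \int[mu]_(x in `[a, b]) (g x)%:E + eps%:E)%E &
    forall x, a <= x <= b -> exists2 c : R, g x < c &
      \forall y \near x, a <= y <= b -> (c%:E <= v y)%E].
Proof.
move=> ab eps0 g0 mg.
pose D := `[a, b]%classic.
have mD : measurable D by exact: measurable_itv.
(* Adding d to g costs at most eps / 2 over [a, b]; the summand 1 covers a = b. *)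
pose d := eps / 2 / (b - a + 1).
have ba1 : 0 < b - a + 1 by rewrite ltr_wpDl// subr_ge0.
have d0 : 0 < d by rewrite divr_gt0// divr_gt0.
pose E n := D `&` g @^-1` `[n%:R * d, n.+1%:R * d[.
have mE n : measurable (E n) by exact: mg.
have muD : (mu D < +oo)%E.
  by rewrite /D lebesgue_measure_itv/=; case: ifP => // _; rewrite -EFinB ltry.
have muE n : (mu (E n) < +oo)%E.
  apply: le_lt_trans muD; apply: le_measure; rewrite ?inE;
    [exact: mE|exact: measurable_itv|exact: subIsetl].
(* The excess [U n] minus [E n] will be charged (n + 1) d, so it costs at most eps / 2 / 2^(n + 1),
   summing to eps / 2. *)
pose eta n := eps / 2 / (2 ^ n.+1)%:R / (n.+1%:R * d).
have eta0 n : 0 < eta n.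
  by rewrite divr_gt0// ?mulr_gt0// ?invr_gt0 ?ltr0n ?expn_gt0.
have /choice[U HU] := fun n => lebesgue_regularity_outer (mE n) (muE n) (eta0 n).
have oU n : open (U n) by have [] := HU n.
have EU n : E n `<=` U n by have [] := HU n.
have mUE n : measurable (U n `\` E n).
  by apply: measurableD => //; exact: open_measurable.
pose B n x : \bar R := ((n.+1%:R * d)%:E * (\1_(U n `\` E n) x)%:E)%E.
have B0 n x : (0 <= B n x)%E by rewrite mule_ge0// lee_fin mulr_ge0// ltW.
have mI n : measurable_fun [set: R] (fun x : R => (\1_(U n `\` E n) x : R)%:E).
  by apply/measurable_EFinP; exact: measurable_indic.
have mB n A : measurable_fun A (B n).
  by apply: measurable_funTS; apply: measurable_funeM; exact: mI.
pose v x : \bar R := ((g x + d)%:E + \sum_(n <oo) B n x)%E.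
have gd0 x : (0 <= (g x + d)%:E)%E by rewrite lee_fin addr_ge0// ltW.
have mgd : measurable_fun D (fun x => (g x + d)%:E).
  by apply/measurable_EFinP; exact: measurable_funD.
have mS : measurable_fun D (fun x => \sum_(n <oo) B n x)%E.
  exact: ge0_emeasurable_sum.
exists v; split.
- exact: emeasurable_funD.
- by move=> x; rewrite adde_ge0// nneseries_ge0.
- rewrite ge0_integralD//; last by move=> x _; exact: nneseries_ge0.
  have -> : eps%:E = ((eps / 2)%:E + (eps / 2)%:E)%E.
    by rewrite -EFinD -splitr.
  rewrite [leRHS]addeA; apply: leeD.
    apply: (@le_trans _ _ (\int[mu]_(x in D) ((g x)%:E + d%:E))%E); first exact: lexx.
    rewrite ge0_integralD//; last 2 first.
    + exact/measurable_EFinP.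
    + by move=> x _; rewrite lee_fin ltW.
    apply: leeD => //; rewrite integral_cst//.
    rewrite -[X in (_ * X <= _)%E]/(mu D) /D lebesgue_measure_itv/=.
    case: ifP => _; last by rewrite mule0 lee_fin divr_ge0// ltW.
    rewrite -EFinB -EFinM lee_fin /d mulrAC ler_pdivrMr//.
    by rewrite ler_pM2l ?divr_gt0// lerDl.
    by move=> x _; rewrite lee_fin.
  rewrite integral_nneseries//; last by move=> n; exact: mB.
  have e20 : 0 <= eps / 2 by rewrite divr_ge0// ltW.
  apply: (le_trans _ (epsilon_trick0 xpredT e20)).
  apply: lee_nneseries => [n _ _|n _].
    by apply: integral_ge0 => x _.
  rewrite ge0_integralZl_EFin//; last 2 first.
  + by apply: measurable_funTS; exact: mI.
  + by rewrite mulr_ge0// ltW.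
  rewrite integral_indic//; last exact: mUE.
  apply: (@le_trans _ _ ((n.+1%:R * d)%:E * (eta n)%:E)%E).
    apply: lee_wpmul2l; first by rewrite lee_fin mulr_ge0// ltW.
    have [_ _ /ltW HUn] := HU n; apply: le_trans HUn.
    apply: le_measure; rewrite ?inE; [|exact: mUE|exact: subIsetl].
    by apply: measurableI; [exact: mUE|exact: mD].
  rewrite -EFinM lee_fin /eta mulrCA mulfV ?mulr1//.
  by rewrite mulf_neq0 ?pnatr_eq0// gt_eqF.
move=> x xab.
pose n := Num.truncn (g x / d).
have /andP[nx xn] : n%:R * d <= g x < n.+1%:R * d.
  rewrite -ler_pdivlMr// -ltr_pdivrMr//.
  by apply: truncn_itv; rewrite divr_ge0// ltW.
have Ex : E n x.
  by split => /=; rewrite /D/= ?in_itv//= nx.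
exists (n.+1%:R * d) => //.
have : \forall y \near x, U n y by apply: open_nbhs_nbhs; split => //; exact: EU.
apply: filterS => y Uy yab.
(* On the level set, g y >= n d and the added d reaches (n + 1) d; elsewhere in [U n] the charge
   [B n] alone reaches it. *)
have [Ey|nEy] := pselect (E n y).
  rewrite /v; apply: (@le_trans _ _ (g y + d)%:E); last first.
    by rewrite leeDl// nneseries_ge0.
  case: Ey => _ /=; rewrite in_itv/= => /andP[ny _].
  by rewrite lee_fin -natr1 mulrDl mul1r lerD2r.
rewrite /v; apply: (@le_trans _ _ (\sum_(n <oo) B n y)%E); last exact: leeDr.
rewrite (@nneseriesD1 _ _ n)//; apply: (@le_trans _ _ (B n y)).
  by rewrite /B indicE mem_set// mule1.
by rewrite leeDl// nneseries_ge0.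
Qed.

Lemma derivable_near_lipschitz (f : R -> R) (x c : R) :
  derivable f x 1 -> `|derive1 f x| < c ->
  \forall y \near x, `|f y - f x| <= c * `|y - x|.
Proof.
move=> df; rewrite derive1E => fc.
have /cvgr_norm_lt/(_ _ fc) := df.
move=> [e /= e0 He]; exists e => //= y; rewrite /ball/= => xy.
have [->|yx] := eqVneq y x; first by rewrite !subrr normr0 mulr0.
have yx0 : y - x != 0 by rewrite subr_eq0.
have := He (y - x); rewrite /= sub0r normrN distrC => /(_ xy yx0) /ltW.
rewrite /GRing.scale/= mulr1 subrK normrM normfV mulrC.
by rewrite (distrC x y) ler_pdivrMr ?normr_gt0.
Qed.

(** Let v exceed |f'| as in [vitali_caratheodory]. Around each x, the slopes of f through x stay
    below some c > |f' x| while v >= c, so the inequality against the integral of v passes across x.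
    Letting eps tend to 0 replaces v by |f'|. *)
Lemma norm_sub_le_integral (f : R -> R) (a b : R) : a <= b ->
  (forall x, a <= x <= b -> derivable f x 1) -> measurable_fun `[a, b] (derive1 f) ->
  (`|f b - f a|%:E <= \int[mu]_(x in `[a, b]) `|derive1 f x|%:E)%E.
Proof.
move=> ab df mf; apply/lee_addgt0Pr => eps eps0.
have mnf : measurable_fun `[a, b] (fun x => `|derive1 f x|).
  exact: measurableT_comp.
have [v [mv v0 vint hv]] :=
  vitali_caratheodory ab eps0 (fun x => normr_ge0 (derive1 f x)) mnf.
apply: le_trans vint.
pose V (x : R) : \bar R := (\int[mu]_(s in `[a, x]) v s)%E.
suff : a <= b /\ b <= b -> (`|f b - f a|%:E <= V b)%E by apply.
apply: (@straddle_induction (fun x => a <= x /\ x <= b ->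
   (`|f x - f a|%:E <= V x)%E) a b) => //.
  by move=> _; rewrite subrr normr0; apply: integral_ge0.
move=> x xab; have [c fc hc] := hv x xab.
have [e e0 He] := derivable_near_lipschitz (df x xab) fc.
have [e' e'0 He'] := hc.
exists (Num.min e e'); first by rewrite lt_min e0 e'0.
move=> y z /andP[]; rewrite ltrBlDr -ltrBlDl lt_min => /andP[xye xye'] yx.
move=> /andP[xz]; rewrite -ltrBlDl lt_min => /andP[zxe zxe'] ay zb Py [az _].
have yb : y <= b by rewrite (le_trans yx)// (le_trans xz).
have yz := le_trans yx xz.
have c0 : 0 <= c by rewrite (le_trans _ (ltW fc)).
have fyz : `|f z - f y| <= c * (z - y).
  have hz : `|f z - f x| <= c * (z - x).
    rewrite -[z - x]ger0_norm ?subr_ge0//; apply: (He z).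
    by rewrite /ball/= distrC ger0_norm ?subr_ge0.
  have hy : `|f y - f x| <= c * (x - y).
    rewrite -[x - y]ger0_norm ?subr_ge0// (distrC x y); apply: (He y).
    by rewrite /ball/= ger0_norm ?subr_ge0.
  rewrite -(subrKA (f x)) (le_trans (ler_normD _ _))//.
  rewrite (_ : z - y = (z - x) + (x - y)); last by ring.
  by rewrite mulrDr lerD// distrC.
rewrite /V (@itv_bndbnd_setU _ _ _ (BRight y)) ?bnd_simp//.
have sub : `]y, z] `<=` `[a, b].
  move=> s /=; rewrite !in_itv/= => /andP[ys sz].
  by rewrite (le_trans ay (ltW ys)) (le_trans sz).
rewrite ge0_integral_setU//; last 2 first.
- apply: measurable_funS mv => //; rewrite subUset; split => //.
  by apply: subset_itvl; rewrite bnd_simp.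
- apply/disj_setPS => s [] /=; rewrite !in_itv/= => /andP[_ sy] /andP[ys _].
  by have := lt_le_trans ys sy; rewrite ltxx.
apply: (@le_trans _ _ (`|f y - f a|%:E + (c * (z - y))%:E)%E).
  rewrite -EFinD lee_fin -(subrKA (f y)) (le_trans (ler_normD _ _))//.
  by rewrite addrC lerD.
apply: leeD; first exact: Py.
have -> : ((c * (z - y))%:E = \int[mu]_(s in `]y, z]) cst c%:E s)%E.
  rewrite integral_cst// -[X in (_ = _ * X)%E]/(mu `]y, z]).
  rewrite lebesgue_measure_itv/= lte_fin.
  case: ltP => yz'; first by rewrite -EFinB.
  by rewrite mule0 (_ : z = y) ?subrr ?mulr0//; apply: le_anti; rewrite yz yz'.
apply: ge0_le_integral => //.
- exact: measurable_funS mv.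
move=> s ys; apply: He'; last by have := sub _ ys; rewrite /= in_itv.
move: ys; rewrite /= in_itv/= /ball/= => /andP[ys sz].
by rewrite ltr_norml; apply/andP; split; lra.
Qed.
Lemma integral_derive1 (f : R -> R) (a b : R) : a <= b ->
  (forall x, a <= x <= b -> derivable f x 1) ->
  mu.-integrable `[a, b] (EFin \o derive1 f) ->
  \int[mu]_(x in `[a, b]) derive1 f x = f b - f a.
Proof.
move=> ab df intf.
have mf : measurable_fun `[a, b] (derive1 f).
  by apply/measurable_EFinP; exact: measurable_int intf.
have muab : (mu `[a, b] < +oo)%E.
  by rewrite lebesgue_measure_itv/=; case: ifP => // _; rewrite -EFinB ltry.
have [g [cg ig eg]] := approximation_continuous_integrable (measurable_itv _) muab intf.
pose I := \int[mu]_(x in `[a, b]) derive1 f x.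
(* f' is approximated in L^1 by continuous [g n]. Replacing f' by [g n] changes both I and f b - f a
   by at most the L^1 error, which accounts for the division by 2. *)
suff h n : ((`|I - (f b - f a)| / 2)%:E <=
    \int[mu]_(x in `[a, b]) `|(derive1 f x - g n x)%:E|)%E.
  apply/eqP; rewrite -subr_eq0 -normr_le0 -/I.
  have := lime_ge (cvgP _ eg) (nearW _ h).
  by rewrite (cvg_lim _ eg)// lee_fin ler_pdivrMr// mul0r; apply.
(* Starting at a - 1 puts a in the interior, so that G has two-sided derivatives on all of
   [a, b]. *)
pose G x := \int[mu]_(t in `[a - 1, x]) g n t.
have igb : mu.-integrable `[a - 1, b + 1] (EFin \o g n).
  apply: continuous_compact_integrable; first exact: segment_compact.
  by apply: continuous_subspaceT; exact: cg.
have dG x : a <= x <= b -> derivable G x 1 /\ derive1 G x = g n x.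
  move=> /andP[ax xb]; apply: (continuous_FTC1_closed _ igb); last exact: cg.
  - by rewrite (le_lt_trans xb)// ltrDl.
  - by rewrite (lt_le_trans _ ax)// gtrDl.
have dfG x : a <= x <= b ->
    derivable (f \- G) x 1 /\ derive1 (f \- G) x = derive1 f x - g n x.
  move=> xab; have [dGx <-] := dG x xab.
  split; first exact: (@derivableB _ _ _ f G _ _ (df x xab) dGx).
  by rewrite !derive1E (@deriveB _ _ _ f G _ _ (df x xab) dGx).
have intd : mu.-integrable `[a, b] (fun x => (derive1 f x - g n x)%:E).
  by apply: (@integrableB _ _ _ mu `[a, b] _ (EFin \o derive1 f) (EFin \o g n)).
have eqd : {in `[a, b]%classic, (fun x => derive1 f x - g n x) =1 derive1 (f \- G)}.
  move=> x; rewrite inE/= in_itv/= => xab.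
  by have [_ ->] := dfG x xab.
have mfG : measurable_fun `[a, b] (derive1 (f \- G)).
  apply: (eq_measurable_fun _ eqd).
  by apply/measurable_EFinP; exact: measurable_int intd.
have := norm_sub_le_integral ab (fun x xab => (dfG x xab).1) mfG.
have -> : (\int[mu]_(x in `[a, b]) `|derive1 (f \- G) x|%:E =
          \int[mu]_(x in `[a, b]) `|(derive1 f x - g n x)%:E|)%E.
  by apply: eq_integral => x xab; rewrite -eqd.
have -> : (f \- G) b - (f \- G) a = (f b - f a) - \int[mu]_(x in `[a, b]) g n x.
  rewrite -Rintegral_itv_obnd_cbnd; last first.
    apply: integrableS (ig n) => //; exact: subset_itv_oc_cc.
  rewrite -(@Rintegral_itvB _ _ (BLeft (a - 1)))//; last 2 first.
  - apply: integrableS igb => //; apply: subset_itvl; rewrite bnd_simp lerDl//.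
  - by rewrite bnd_simp gerBl.
  by rewrite /G /=; ring.
have hI : (`|I - \int[mu]_(x in `[a, b]) g n x|%:E <=
    \int[mu]_(x in `[a, b]) `|(derive1 f x - g n x)%:E|)%E.
  rewrite /I -RintegralB// EFin_normr_Rintegral//.
  by apply: le_abse_integral => //; exact: measurable_int intd.
set J := (\int[mu]_(x in `[a, b]) `|(derive1 f x - g n x)%:E|)%E in hI *.
set K := \int[mu]_(x in `[a, b]) g n x in hI *.
have J0 : (0 <= J)%E by apply: integral_ge0 => x _; rewrite lee_fin.
case: J J0 hI => [j||]//; last by move=> *; rewrite leey.
rewrite !lee_fin => j0 h1 h2.
have := ler_normB (I - K) (f b - f a - K).
rewrite (_ : _ - _ - (_ - _ - _) = I - (f b - f a)); last by ring.
lra.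
Qed.
End lebesgue_ftc.

(** * Caputo derivative of power series in [t `^ nu] *)

Section caputo_kernel.
Context {R : realType}.
Local Notation mu := (@lebesgue_measure R).

Lemma caputo_order1 (nu : R) : 0 < nu -> nu <= 1 -> caputo_order nu = 1.
Proof.
move=> nu0 nu1; rewrite /caputo_order (@ceil_def _ _ 1)// subrr nu0.
by rewrite nu1.
Qed.

(* Agrees with [caputo_integrand] on ]0, t] and vanishes elsewhere. *)
Definition caputo_kernel (nu : R) (u : R -> R) (t s : R) : R :=
  if 0 < s then powker (1 - nu) (t - s) * derive1 u s else 0.

Lemma caputo_integrandE (nu : R) (u : R -> R) (t s : R) :
  0 < nu -> nu <= 1 -> 0 < s <= t ->
  caputo_integrand nu u t s = caputo_kernel nu u t s.
Proof.
move=> nu0 nu1 /andP[s0 st].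
rewrite /caputo_integrand caputo_order1// /caputo_kernel s0 /=.
rewrite (_ : 1 + nu - 1 = nu); last by ring.
rewrite /powker subr_gt0; case: ltP => ts.
  by rewrite (_ : 1 - nu - 1 = - nu) ?powRN 1?mulrC//; ring.
(* At s = t both sides vanish: 0 to the power nu is 0, and so is its inverse by convention. *)
have -> : t - s = 0 by apply/eqP; rewrite subr_eq0 eq_le st ts.
by rewrite powR0 ?gt_eqF// invr0 mulr0 mul0r.
Qed.

Lemma caputo_kernel_restrict (nu : R) (u : R -> R) (t : R) :
  caputo_kernel nu u t = caputo_kernel nu u t \_ `]0, t].
Proof.
apply/funext => s; rewrite patchE; case: ifPn => // /negP; rewrite inE/= in_itv/=.
move=> /negP; rewrite negb_and /caputo_kernel.
case: ltP => //= s0; rewrite -ltNge => ts.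
by rewrite powker_le0E ?mul0r// subr_le0 ltW.
Qed.

(** On [0, t] the two functions can differ only at 0, a null set, so the default value of
    [derive1 u 0] is harmless. *)
Lemma caputo_integrableP (nu : R) (u : R -> R) (t : R) : 0 < nu -> nu <= 1 ->
  mu.-integrable `[0, t] (EFin \o caputo_integrand nu u t) <->
  mu.-integrable [set: R] (EFin \o caputo_kernel nu u t).
Proof.
move=> nu0 nu1.
have e : {in `]0, t]%classic, EFin \o caputo_integrand nu u t =1
                              EFin \o caputo_kernel nu u t}.
  by move=> s; rewrite inE/= in_itv/= => st; rewrite caputo_integrandE.
have -> : EFin \o caputo_kernel nu u t = (EFin \o caputo_kernel nu u t) \_ `]0, t].
  by rewrite {1}caputo_kernel_restrict restrict_EFin.
rewrite -integrable_mkcond//.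
split=> h.
  have {}h : mu.-integrable `]0, t] (EFin \o caputo_integrand nu u t).
    by apply: integrableS h => //; exact: subset_itv_oc_cc.
  by apply: eq_integrable h => // s st; rewrite e.
have {}h : mu.-integrable `]0, t] (EFin \o caputo_integrand nu u t).
  by apply: eq_integrable h => // s st; rewrite e.
have [mh fh] := integrableP _ _ _ h.
have mh' := (emeasurable_fun_itv_obnd_cbndP _ _ _).1 mh.
apply/integrableP; split=> //.
rewrite -integral_itv_obnd_cbnd//.
by apply: measurableT_comp.
Qed.

Lemma caputoE (nu : R) (u : R -> R) (t : R) : 0 < nu < 1 ->
  mu.-integrable [set: R] (EFin \o caputo_kernel nu u t) ->
  caputo nu u t = (Gamma (1 - nu))^-1 * \int[mu]_s caputo_kernel nu u t s.
Proof.
move=> /andP[nu0 nu1] ik.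
rewrite /caputo caputo_order1 ?(ltW nu1)//= (lt_eqF nu1); congr (_ * _).
have /integrableP[mi _] := (caputo_integrableP u t nu0 (ltW nu1)).2 ik.
rewrite caputo_kernel_restrict -Rintegral_mkcond /Rintegral.
rewrite -integral_itv_obnd_cbnd; last first.
  by apply: measurable_funS mi => //; exact: subset_itv_oc_cc.
congr fine; apply: eq_integral => s; rewrite inE/= in_itv/= => st.
by rewrite caputo_integrandE// ltW.
Qed.

End caputo_kernel.

(** * Coefficient sequences of entire power series *)

Section entire_series.
Context {R : realType}.
Local Notation mu := (@lebesgue_measure R).

(* Equivalently, [c] is the coefficient sequence of an entire power series. *)
Definition superexp_decay (c : R ^nat) : Prop :=
  forall rho, 0 < rho -> exists C, forall j, `|c j| <= C * rho ^+ j.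

Definition psum (c : R ^nat) (x : R) : R := limn (pseries c x).

Lemma superexp_decay_normed_cvg (c : R ^nat) (x : R) : superexp_decay c ->
  cvgn (series (fun j => `|c j| * `|x| ^+ j)).
Proof.
move=> cd; have x1 : 0 < `|x| + 1 by rewrite ltr_wpDl.
(* This rate makes the dominating series geometric of ratio 1/2, also when x = 0. *)
have [|C cC] := cd (2 * (`|x| + 1))^-1; first by rewrite invr_gt0 mulr_gt0.
have C0 : 0 <= C by have := cC 0; rewrite expr0 mulr1; apply: le_trans.
apply: (@series_le_cvg _ _ (geometric C 2^-1)).
- by move=> n; rewrite mulr_ge0.
- by move=> n; rewrite /geometric /= mulr_ge0// exprn_ge0// invr_ge0.
- move=> n; rewrite /geometric/=.
  apply: (@le_trans _ _ (C * (2 * (`|x| + 1))^-1 ^+ n * (`|x| + 1) ^+ n)).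
    by apply: ler_pM => //; rewrite lerXn2r ?nnegrE ?(ltW x1)// lerDl.
  rewrite -mulrA -exprMn (_ : _^-1 * (`|x| + 1) = 2^-1)//.
  by rewrite invfM -mulrA mulVf ?mulr1// gt_eqF.
- by apply: is_cvg_geometric_series; rewrite ger0_norm ?invr_ge0// invf_lt1// ltr1n.
Qed.

Lemma superexp_decay_cvg (c : R ^nat) (x : R) : superexp_decay c ->
  cvgn (pseries c x).
Proof.
move=> /superexp_decay_normed_cvg cd; apply: normed_cvg.
rewrite (_ : [normed _] = series (fun j => `|c j| * `|x| ^+ j)) //.
by apply/funext => n; apply: eq_bigr => i _ /=; rewrite normrM normrX.
Qed.

(** Differentiation brings a factor j + 1 <= 2^(j + 1), absorbed by using the decay at rate rho /
    2. *)
Lemma superexp_decay_diffs (c : R ^nat) : superexp_decay c ->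
  superexp_decay (pseries_diffs c).
Proof.
move=> cd rho rho0; have [|C cC] := cd (rho / 2); first by rewrite divr_gt0.
exists (C * rho) => j; rewrite /pseries_diffs normrM ger0_norm//.
have C0 : 0 <= C by have := cC 0; rewrite expr0 mulr1; apply: le_trans.
apply: (@le_trans _ _ (2 ^+ j.+1 * (C * (rho / 2) ^+ j.+1))).
  apply: ler_pM => //; rewrite -natrX ler_nat.
  exact: ltnW (ltn_expl _ _).
by rewrite mulrCA -exprMn mulrCA mulfV// mulr1 -mulrA -exprS.
Qed.

Lemma is_derive_psum (c : R ^nat) (x : R) : superexp_decay c ->
  is_derive x 1 (psum c) (psum (pseries_diffs c) x).
Proof.
move=> cd; apply: (@pseries_snd_diffs _ _ (`|x| + 1)).
- exact: superexp_decay_cvg.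
- exact/superexp_decay_cvg/superexp_decay_diffs.
- exact/superexp_decay_cvg/superexp_decay_diffs/superexp_decay_diffs.
- by rewrite [ltRHS]ger0_norm// ltrDl.
Qed.

Lemma psum0 (c : R ^nat) : psum c 0 = c 0.
Proof.
apply: cvg_lim => //; apply: cvg_near_cst; near=> n.
rewrite /pseries /series /= -(ltn_predK (_ : 0 < n)%N)//; last by near: n; exists 1%N.
rewrite big_nat_recl// expr0 mulr1 big1 ?addr0// => i _.
by rewrite expr0n mulr0.
Unshelve. all: by end_near. Qed.

Lemma psum_lin (a b : R) (c d : R ^nat) (x : R) :
  superexp_decay c -> superexp_decay d ->
  psum (fun j => a * c j + b * d j) x = a * psum c x + b * psum d x.
Proof.
move=> cc dd; apply: cvg_lim => //.
rewrite (_ : pseries _ x = (fun n => a * pseries c x n + b * pseries d x n)); last first.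
  apply/funext => n; rewrite /pseries /series /= !mulr_sumr -big_split/=.
  by apply: eq_bigr => i _; ring.
by apply: cvgD; apply: cvgMl_tmp; exact: superexp_decay_cvg.
Qed.

Lemma superexp_decay_Gamma (nu C K : R) (a : R ^nat) : 0 < nu -> 0 < K ->
  (forall j, `|a j| <= C * K ^+ j) ->
  superexp_decay (fun j => a j / Gamma (nu * j%:R + 1)).
Proof.
move=> nu0 K0 aC rho rho0.
(* Then A^(nu j) = (K / rho)^j, and [Gamma_ge] turns the bound C K^j into C exp A rho^j. *)
pose A := (K / rho) `^ nu^-1.
have A0 : 0 < A by rewrite powR_gt0// divr_gt0.
exists (C * expR A) => j.
have x1 : 1 <= nu * j%:R + 1 by rewrite lerDr mulr_ge0// ltW.
have G0 : 0 < Gamma (nu * j%:R + 1) by apply: Gamma_gt0; rewrite (lt_le_trans ltr01).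
have AE : A `^ (nu * j%:R + 1 - 1) = (K / rho) ^+ j.
  rewrite addrK /A -powRrM mulrA mulVf ?gt_eqF// mul1r powR_mulrn//.
  by rewrite divr_ge0// ltW.
rewrite normrM normfV (gtr0_norm G0) ler_pdivrMr//.
apply: le_trans (aC j) _.
have C0 : 0 <= C by have := aC 0; rewrite expr0 mulr1; apply: le_trans.
rewrite -2!mulrA ler_wpM2l//.
have := Gamma_ge x1 A0; rewrite AE.
move=> h; apply: le_trans (_ : expR A * (rho ^+ j * ((K / rho) ^+ j * expR (- A))) <= _).
  rewrite expRN exprMn exprVn le_eqVlt; apply/orP; left; apply/eqP; field.
  by rewrite !gt_eqF ?exprn_gt0 ?expR_gt0.
by rewrite !ler_wpM2l ?expR_ge0 ?exprn_ge0// ltW.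
Qed.

End entire_series.

(** * The Caputo derivative as a shift of coefficients *)

Section caputo_series.
Context {R : realType}.
Local Notation mu := (@lebesgue_measure R).

(** Dividing by Gamma (nu j + 1) is the fractional analogue of dividing by j!. For a geometric
    sequence [a] this is a one-parameter Mittag-Leffler function. *)
Definition ml_sum (nu : R) (a : R ^nat) (t : R) : R :=
  psum (fun j => a j / Gamma (nu * j%:R + 1)) (t `^ nu).

Variables (nu C K : R) (a : R ^nat).
Hypotheses (nu0 : 0 < nu) (nu1 : nu <= 1) (K0 : 0 < K).
Hypothesis aC : forall j, `|a j| <= C * K ^+ j.

Let c (j : nat) : R := a j / Gamma (nu * j%:R + 1).
Let cd : superexp_decay c. Proof. exact: superexp_decay_Gamma nu0 K0 aC. Qed.
Let dd : superexp_decay (pseries_diffs c). Proof. exact: superexp_decay_diffs. Qed.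

Lemma nu_diffsE (i : nat) :
  nu * pseries_diffs c i = a i.+1 / Gamma (nu * i.+1%:R).
Proof.
have p0 : 0 < nu * i.+1%:R by rewrite mulr_gt0.
rewrite /pseries_diffs /c GammaD1//; field.
  by rewrite nat1r pnatr_eq0 !gt_eqF ?Gamma_gt0.
Qed.

Lemma is_derive_ml_sum (t : R) : 0 < t ->
  is_derive t 1 (ml_sum nu a) (nu * t `^ (nu - 1) * psum (pseries_diffs c) (t `^ nu)).
Proof.
move=> t0; rewrite mulrC.
apply: (@is_derive1_comp _ (psum c) (fun s => s `^ nu)).
  exact: is_derive_psum.
exact: is_derive1_powR.
Qed.

Lemma derive1_ml_sum (t : R) : 0 < t ->
  derive1 (ml_sum nu a) t = nu * t `^ (nu - 1) * psum (pseries_diffs c) (t `^ nu).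
Proof. by move=> t0; rewrite derive1E; have [_ ->] := is_derive_ml_sum t0. Qed.

(** Partial sums of the Caputo kernel of [ml_sum nu a], with coefficients from [nu_diffsE]. The
    index starts at 1 because the constant term has derivative 0. *)
Let f_ (t : R) (n : nat) (s : R) : R := powker (1 - nu) (t - s) *
  \sum_(0 <= i < n) a i.+1 / Gamma (nu * i.+1%:R) * powker (nu * i.+1%:R) s.

Let f_E t n s : f_ t n s =
  \sum_(0 <= i < n) a i.+1 / Gamma (nu * i.+1%:R) *
     (powker (1 - nu) (t - s) * powker (nu * i.+1%:R) s).
Proof. by rewrite /f_ mulr_sumr; apply: eq_bigr => i _; rewrite mulrCA. Qed.

Let powkerS (i : nat) (s : R) : 0 < s ->
  powker (nu * i.+1%:R) s = powker nu s * (s `^ nu) ^+ i.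
Proof.
move=> s0; rewrite !powker_gt0E// -powR_mulrn ?powR_ge0// -powRrM -powRD.
  by congr (_ `^ _); rewrite -natr1; ring.
by rewrite (gt_eqF s0) implybT.
Qed.

Let f_pseries t n s : 0 < s ->
  f_ t n s = powker (1 - nu) (t - s) * (nu * s `^ (nu - 1)) *
    pseries (pseries_diffs c) (s `^ nu) n.
Proof.
move=> s0; rewrite /f_ -mulrA; congr (_ * _); rewrite /pseries/series/= mulr_sumr.
apply: eq_bigr => i _; rewrite powkerS// -nu_diffsE powker_gt0E//; ring.
Qed.

Lemma caputo_kernel_cvg (t s : R) :
  f_ t n s @[n --> \oo] --> caputo_kernel nu (ml_sum nu a) t s.
Proof.
rewrite /caputo_kernel; case: ltP => s0.
  rewrite derive1_ml_sum// mulrA.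
  under eq_fun do rewrite f_pseries//.
  by apply: cvgMl_tmp; exact: superexp_decay_cvg.
apply: cvg_near_cst; apply: nearW => n.
by rewrite f_E big1// => i _; rewrite (powker_le0E _ s0) !mulr0.
Qed.

Lemma integrable_powker_conv (b b' t : R) : 0 < b -> 0 < b' ->
  mu.-integrable [set: R] (EFin \o (fun s => powker b (t - s) * powker b' s)).
Proof.
move=> b0 b'0; apply/integrableP; split.
  exact: measurable_powker_conv.
under eq_integral do rewrite gee0_abs ?powker_conv_ge0//.
by rewrite powker_conv// ltry.
Qed.

Lemma integral_caputo_kernel_ml_sum (t : R) : nu < 1 -> 0 < t ->
  mu.-integrable [set: R] (EFin \o caputo_kernel nu (ml_sum nu a) t) /\
  \int[mu]_s caputo_kernel nu (ml_sum nu a) t s =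
    Gamma (1 - nu) * ml_sum nu (fun j => a j.+1) t.
Proof.
move=> nult1 t0.
have onu : 0 < 1 - nu by rewrite subr_gt0.
(* Absolute values summed at t^nu bound all partial sums of the differentiated series for 0 < s < t,
   so a single Beta integrand dominates the sequence. *)
pose B := nu * limn (series (fun j => `|pseries_diffs c j| * `|t `^ nu| ^+ j)).
have fsE t' n : (fun s => (f_ t' n s)%:E) = (fun s => \sum_(0 <= i < n)
    ((a i.+1 / Gamma (nu * i.+1%:R))%:E *
      (powker (1 - nu) (t' - s) * powker (nu * i.+1%:R) s)%:E))%E.
  by apply/funext => s; rewrite f_E -sumEFin.
have fint t' n : mu.-integrable [set: R] (EFin \o f_ t' n).
  rewrite /comp fsE; apply: integrable_sum => // i _.
  apply: integrableZl => //.
  by apply: integrable_powker_conv => //; rewrite mulr_gt0.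
have cl s : limn (series (fun j => `|pseries_diffs c j| * `|s `^ nu| ^+ j)) =
  limn (series (fun j => `|pseries_diffs c j| * (s `^ nu) ^+ j)).
  by rewrite ger0_norm ?powR_ge0.
have fB n s : `|f_ t n s| <= B * (powker (1 - nu) (t - s) * powker nu s).
  have [s0|s0] := leP s 0.
    rewrite f_E big1 ?(powker_le0E _ s0) ?mulr0 ?normr0// => i _.
    by rewrite !(powker_le0E _ s0) !mulr0.
  have [ts|ts] := leP (t - s) 0.
    by rewrite /f_ !(powker_le0E _ ts) !mul0r normr0 mulr0.
  rewrite f_pseries// -mulrA normrM ger0_norm ?powker_ge0// [leRHS]mulrCA.
  rewrite ler_wpM2l ?powker_ge0// powker_gt0E// /B -!mulrA normrM ger0_norm ?(ltW nu0)//.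
  rewrite ler_wpM2l ?(ltW nu0)// normrM ger0_norm ?powR_ge0// [leRHS]mulrC.
  rewrite ler_wpM2l ?powR_ge0//.
  apply: (@le_trans _ _ (series (fun j => `|pseries_diffs c j| * `|t `^ nu| ^+ j) n)).
    rewrite /series/= (le_trans (ler_norm_sum _ _ _))//.
    apply: ler_sum => i _; rewrite normrM normrX ler_wpM2l// lerXn2r ?nnegrE//.
    rewrite !ger0_norm ?powR_ge0// ge0_ler_powR ?nnegrE ?(ltW nu0) ?(ltW s0) ?(ltW t0)//.
    by rewrite ltW// -subr_gt0.
  apply: nondecreasing_cvgn_le; last exact: superexp_decay_normed_cvg dd.
  by apply/nondecreasing_seqP => m; rewrite /series/= big_nat_recr//= lerDl mulr_ge0.
have [ik _ ck] : [/\ mu.-integrable setT (EFin \o caputo_kernel nu (ml_sum nu a) t),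
   (\int[mu]_s `|(f_ t n s)%:E - (caputo_kernel nu (ml_sum nu a) t s)%:E| @[n --> \oo] --> 0)%E
   & (\int[mu]_s (f_ t n s)%:E @[n --> \oo] -->
     \int[mu]_s (caputo_kernel nu (ml_sum nu a) t s)%:E)%E].
  have mf_ n : measurable_fun [set: R] (fun s => (f_ t n s)%:E).
    exact: measurable_int (fint t n).
  have cf_ s : ((f_ t n s)%:E @[n --> \oo] --> (caputo_kernel nu (ml_sum nu a) t s)%:E)%E.
    by apply: cvg_EFin; [exact: nearW|exact: caputo_kernel_cvg].
  apply: (@dominated_convergence _ _ _ mu setT _ (fun n s => (f_ t n s)%:E) _
    (fun s => B%:E * (powker (1 - nu) (t - s) * powker nu s)%:E)%E) => //.
  - exact: (emeasurable_fun_cvg (fun n s => (f_ t n s)%:E)) mf_ (fun s _ => cf_ s).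
  - by apply: aeW => s _; exact: cf_.
  - by apply: integrableZl => //; exact: integrable_powker_conv.
  - by apply: aeW => s n _; rewrite -EFinM lee_fin fB.
split=> //.
have fintE n : (\int[mu]_s (f_ t n s)%:E = (Gamma (1 - nu) *
    pseries (fun j => a j.+1 / Gamma (nu * j%:R + 1)) (t `^ nu) n)%:E)%E.
  rewrite fsE integral_sum//; last first.
    move=> i; apply: integrableZl => //.
    by apply: integrable_powker_conv => //; rewrite mulr_gt0.
  rewrite /pseries/series/= mulr_sumr -sumEFin; apply: eq_bigr => i _.
  rewrite integralZl//; last by apply: integrable_powker_conv => //; rewrite mulr_gt0.
  have nui : 0 < nu * i.+1%:R by rewrite mulr_gt0.
  (* The exponents 1 - nu and nu (i + 1) add up to nu i + 1: the Beta integral restores the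
     normalisation of the i-th term, now carrying the coefficient of index i + 1. *)
  rewrite powker_conv// -EFinM (_ : 1 - nu + _ = nu * i%:R + 1); last first.
    by rewrite -natr1; ring.
  rewrite powker_gt0E// addrK powRrM powR_mulrn ?powR_ge0//; congr EFin.
  have cancel (x g1 g2 g3 z : R) : g1 != 0 -> x / g1 * (g2 * g1 / g3 * z) = g2 * (x / g3 * z).
    by move=> g10; rewrite -[RHS]mul1r -(mulVf g10); ring.
  by apply: cancel; rewrite gt_eqF// Gamma_gt0.
suff ck' : (\int[mu]_s (f_ t n s)%:E @[n --> \oo] -->
    (Gamma (1 - nu) * ml_sum nu (fun j => a j.+1) t)%:E)%E.
  by rewrite /Rintegral (cvg_unique _ ck ck').
rewrite (_ : (fun n => _) = fun n => (Gamma (1 - nu) *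
    pseries (fun j => a j.+1 / Gamma (nu * j%:R + 1)) (t `^ nu) n)%:E);
  last by apply/funext.
apply: cvg_EFin; first exact: nearW.
apply: cvgMl_tmp; apply: superexp_decay_cvg.
apply: (@superexp_decay_Gamma _ nu (C * K) K) => // j.
by rewrite -mulrA -exprS.
Qed.

Lemma caputo_derivable_ml_sum : caputo_derivable nu (ml_sum nu a).
Proof.
rewrite /caputo_derivable caputo_order1//; split=> [[|//] s _ s0|nu1' t t0].
  by have [] := is_derive_ml_sum s0.
apply/caputo_integrableP => //.
by apply: (integral_caputo_kernel_ml_sum _ t0).1; rewrite lt_neqAle nu1'.
Qed.

Lemma caputo_ml_sum (t : R) : 0 < t ->
  caputo nu (ml_sum nu a) t = ml_sum nu (fun j => a j.+1) t.
Proof.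
move=> t0; have [nult1|] := boolP (nu < 1).
  have [ik ikE] := integral_caputo_kernel_ml_sum nult1 t0.
  rewrite caputoE ?nu0// ikE mulrA mulVf ?mul1r//.
  by rewrite gt_eqF// Gamma_gt0// subr_gt0.
move=> nu1'; have nuE : nu = 1.
  by apply/eqP; rewrite eq_le nu1 leNgt nu1'.
rewrite /caputo caputo_order1//= nuE eqxx/= -nuE derive1_ml_sum//.
rewrite nuE subrr powRr0 mulr1 mul1r /ml_sum; congr (psum _ _).
apply/funext => j; have := nu_diffsE j; rewrite nuE !mul1r => ->.
by rewrite natr1.
Qed.

Lemma ml_sum0 : ml_sum nu a 0 = a 0.
Proof.
by rewrite /ml_sum powR0 ?gt_eqF// psum0 mulr0 add0r Gamma1 divr1.
Qed.

Lemma ml_sum_cvg0 : ml_sum nu a t @[t --> 0^'+] --> ml_sum nu a 0.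
Proof.
rewrite {2}/ml_sum powR0 ?gt_eqF//.
apply: (cvg_comp _ _ (powR_cvg0 nu0)); apply: derivable1_cvg.
by have [] := is_derive_psum 0 cd.
Qed.

End caputo_series.

(** * Uniqueness *)

Section uniqueness_tools.
Context {R : realType}.
Local Notation mu := (@lebesgue_measure R).

(** The substitution s = t - r / C gives the Gamma integral. It is an equality because s ranges down
    to -oo, and C^(- nu) is the contraction factor of the weighted estimate. *)
Lemma integral_powker_expR (nu C t : R) : 0 < nu -> 0 < C ->
  (\int[mu]_s (powker nu (t - s) * expR (C * s))%:E =
   (expR (C * t) * C `^ (- nu) * Gamma nu)%:E)%E.
Proof.
move=> nu0 C0.
pose f (s : R) : \bar R := (powker nu (t - s) * expR (C * s))%:E.
have mf : measurable_fun [set: R] f.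
  apply/measurable_EFinP; apply: measurable_funM.
    by apply: measurableT_comp; [exact: measurable_powker|exact: measurable_funB].
  by apply: measurableT_comp => //; exact: measurable_funM.
have f0 s : (0 <= f s)%E by rewrite lee_fin mulr_ge0 ?powker_ge0 ?expR_ge0.
have Ci : 0 < C^-1 by rewrite invr_gt0.
rewrite -[LHS]/(\int[mu]_s f s)%E ge0_integralT_opp//.
pose g (s : R) : \bar R := f (- s).
have mg : measurable_fun [set: R] g by exact: measurableT_comp.
rewrite (@ge0_integralT_affine _ g C^-1 (- t) Ci mg (fun s => f0 (- s))).
transitivity (C^-1%:E * \int[mu]_s ((expR (C * t) * C^-1 `^ (nu - 1))%:E *
    (powker nu s * expR (- s))%:E))%E.
  congr (_ * _)%E; apply: eq_integral => s _; rewrite /g /f -EFinM; congr EFin.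
  rewrite (_ : t - - (C^-1 * s - t) = C^-1 * s + 0 * t); last by ring.
  rewrite mul0r addr0 powkerM// (_ : C * _ = C * t + - s); last by field; rewrite gt_eqF.
  by rewrite expRD; ring.
rewrite ge0_integralZl_EFin//; last 3 first.
- by move=> s _; exact: gamma_integrand_ge0.
- exact: measurable_gamma_integrand.
- by rewrite mulr_ge0 ?powR_ge0 ?expR_ge0.
rewrite EFin_Gamma// -!EFinM; congr EFin.
have -> : C `^ (- nu) = C^-1 * C^-1 `^ (nu - 1).
  rewrite -{1}(powRr1 (ltW Ci)) -powRD ?(gt_eqF Ci) ?implybT//.
  rewrite (_ : 1 + (nu - 1) = nu); last by ring.
  by rewrite -powR_inv1 ?(ltW C0)// -powRrM mulN1r.
ring.
Qed.

Lemma powker_conv_shift (a b t r : R) : 0 < a -> 0 < b ->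
  (\int[mu]_s (powker a (t - s) * powker b (s - r))%:E =
   (Gamma a * Gamma b / Gamma (a + b) * powker (a + b) (t - r))%:E)%E.
Proof.
move=> a0 b0.
pose f (s : R) : \bar R := (powker a (t - s) * powker b (s - r))%:E.
have mf : measurable_fun [set: R] f.
  apply/measurable_EFinP; apply: measurable_funM.
    by apply: measurableT_comp; [exact: measurable_powker|exact: measurable_funB].
  by apply: measurableT_comp; [exact: measurable_powker|exact: measurable_funB].
have f0 s : (0 <= f s)%E by rewrite lee_fin mulr_ge0 ?powker_ge0.
have := @ge0_integralT_affine _ f 1 r ltr01 mf f0.
rewrite mul1e /f => ->; rewrite -(powker_conv (t - r) a0 b0).
by apply: eq_integral => s _; rewrite mul1r addrK opprD addrA addrAC.
Qed.

(** Nothing is known of w at 0 itself, so the fundamental theorem is applied on [x, t] and x tends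
    to 0 from the right: both the integral over ]0, x] and w x vanish in the limit. *)
Lemma integral_derive1_oc (w : R -> R) (t : R) : 0 < t ->
  (forall s, 0 < s -> derivable w s 1) -> w x @[x --> 0^'+] --> 0 ->
  mu.-integrable `]0, t] (EFin \o derive1 w) ->
  \int[mu]_(s in `]0, t]) derive1 w s = w t.
Proof.
move=> t0 dw w0 iw.
pose h := derive1 w \_ `]0, t].
have ih : mu.-integrable `[0, t] (EFin \o h).
  rewrite /h -restrict_EFin; apply/integrable_restrict => //.
  by rewrite setIidr//; exact: subset_itv_oc_cc.
have hE : \int[mu]_(s in `]0, t]) derive1 w s = \int[mu]_(s in `[0, t]) h s.
  rewrite /h -Rintegral_mkcondr setIidr//; exact: subset_itv_oc_cc.
have c0 := @parameterized_integral_cvg_left R 0 t h t0 ih.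
rewrite hE.
have c1 : (parameterized_integral mu 0 x h + (w t - w x)) @[x --> 0^'+] -->
    0 + (w t - 0).
  apply: cvgD; first exact: cvg_at_right_filter.
  by apply: cvgB => //; exact: cvg_cst.
rewrite add0r subr0 in c1; apply: (cvg_unique _ _ c1) => //.
apply: cvg_near_cst; near=> x.
have x0 : 0 < x by [].
have xt : x < t by near: x; exact: nbhs_right_lt.
rewrite -integral_derive1 ?(ltW xt)//; last 2 first.
- by move=> y /andP[xy _]; apply: dw; exact: lt_le_trans xy.
- apply: integrableS iw => // y /=; rewrite !in_itv/= => /andP[xy ->].
  by rewrite (lt_le_trans x0).
have -> : \int[mu]_(s in `[x, t]) derive1 w s = \int[mu]_(s in `]x, t]) h s.
  rewrite -Rintegral_itv_obnd_cbnd; last first.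
    apply: integrableS iw => // y /=; rewrite !in_itv/= => /andP[xy ->].
    by rewrite (lt_trans x0).
  apply: eq_Rintegral => s; rewrite inE/= in_itv/= => /andP[xs st].
  by rewrite /h patchE mem_set//= in_itv/= st (lt_trans x0).
rewrite -(@Rintegral_itvB _ _ (BLeft 0) (BRight t) x)//.
- by rewrite /parameterized_integral; ring.
- by rewrite bnd_simp ltW.
- by rewrite bnd_simp ltW.
Unshelve. all: by end_near. Qed.
End uniqueness_tools.

(** * The homogeneous equation with zero initial value *)

Section uniqueness.
Context {R : realType}.
Local Notation mu := (@lebesgue_measure R).
Variables (lambda nu : R) (w : R -> R).
Hypotheses (lambda0 : 0 < lambda) (nu0 : 0 < nu).
Hypothesis dw : forall s, 0 < s -> derivable w s 1.
Hypothesis w0 : w x @[x --> 0^'+] --> 0.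

(** Multiplied by the integrating factor exp (lambda s), w has derivative 0, so it is constant on
    ]0, t] and equal to its limit 0 at 0. *)
Lemma homogeneous_order1 : (forall t, 0 < t -> derive1 w t = - lambda * w t) ->
  forall t, 0 < t -> w t = 0.
Proof.
move=> wE t t0.
pose g s := w s * expR (lambda * s).
have de (s : R) : is_derive s 1 (fun x : R => expR (lambda * x)) (expR (lambda * s) * lambda).
  apply: (@is_derive1_comp _ expR (fun x => lambda * x)).
  rewrite -[X in is_derive _ _ _ X]mulr1; exact: is_deriveZ.
have dg s : 0 < s -> derivable g s 1 /\ derive1 g s = 0.
  move=> s0; have [d1 d2] := de s; split; first exact: derivableM (dw s0) d1.
  rewrite derive1E (@deriveM _ _ w (fun x => expR (lambda * x)) _ _ (dw s0) d1).
  by rewrite d2 -derive1E wE// /GRing.scale/=; ring.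
have gE s : 0 < s <= t -> g s = g t.
  move=> /andP[s0 st].
  have ig : mu.-integrable `[s, t] (EFin \o derive1 g).
    apply: (eq_integrable _ (fun=> 0%E)) => //; last exact: integrable0.
    move=> x; rewrite inE/= in_itv/= => /andP[sx _] /=.
    by have [_ ->] := dg x (lt_le_trans s0 sx).
  have := integral_derive1 st (fun x xst => (dg x (lt_le_trans s0 (andP xst).1)).1) ig.
  rewrite (@eq_Rintegral _ _ _ _ _ (fun=> 0)); last first.
    move=> x; rewrite inE/= in_itv/= => /andP[sx _].
    by have [_ ->] := dg x (lt_le_trans s0 sx).
  by rewrite Rintegral_cst// mul0r => /esym/eqP; rewrite subr_eq0 => /eqP.
have gc : g x @[x --> 0^'+] --> 0 * expR (lambda * 0).
  apply: cvgM => //; apply: cvg_at_right_filter; apply: derivable1_cvg.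
  by have [] := de 0.
rewrite mul0r in gc.
have gt0 : g t = 0.
  apply: (cvg_unique _ _ gc) => //; apply: cvg_near_cst; near=> x.
  by apply: gE; apply/andP; split => //; near: x; exact: nbhs_right_le.
by move/eqP: gt0; rewrite mulf_eq0 (gt_eqF (expR_gt0 _)) orbF => /eqP.
Unshelve. all: by end_near. Qed.

Hypothesis nu1 : nu < 1.
Hypothesis iw : forall t, 0 < t ->
  mu.-integrable [set: R] (EFin \o caputo_kernel nu w t).
Hypothesis wE : forall t, 0 < t -> caputo nu w t = - lambda * w t.

Let onu : 0 < 1 - nu. Proof. by rewrite subr_gt0. Qed.

(** The Caputo kernel is taken at the later time T + 1: for s in ]0, T], T + 1 - s lies between 1
    and T + 1, so multiplying by the bounded function (T + 1 - s)^nu removes the kernel and leaves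
    w'. *)
Let integrable_derive1 (T : R) : 0 < T -> mu.-integrable `]0, T] (EFin \o derive1 w).
Proof.
move=> T0.
have T1 : 0 < T + 1 by rewrite addr_gt0.
have i1 : mu.-integrable `]0, T] (EFin \o caputo_kernel nu w (T + 1)).
  exact: integrableS (iw T1).
have bd : [bounded (T + 1 - s) `^ nu | s in `]0, T]%classic].
  exists ((T + 1) `^ nu); split; first exact: num_real.
  move=> M ltM s /=; rewrite in_itv/= => /andP[s0 sT].
  rewrite (le_trans _ (ltW ltM))// ger0_norm ?powR_ge0//.
  have a1 : 0 <= T + 1 - s by lra.
  have a2 : T + 1 - s <= T + 1 by lra.
  by apply: ge0_ler_powR; rewrite ?nnegrE ?(ltW nu0) ?(le_trans a1 a2).
have mb : measurable_fun `]0, T] (fun s : R => (T + 1 - s) `^ nu).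
  apply: measurable_funTS; apply: (measurableT_comp (measurable_powR nu)).
  exact: measurable_funB.
apply: eq_integrable (integrableMl _ i1 mb bd) => //.
move=> s; rewrite inE/= in_itv/= => /andP[s0 sT].
have Ts : 0 < T + 1 - s by rewrite subr_gt0 (le_lt_trans sT)// ltrDl.
rewrite /= -EFinM /caputo_kernel s0 powker_gt0E//.
rewrite mulrAC -powRD; last by rewrite (gt_eqF Ts) implybT.
by rewrite (_ : 1 - nu - 1 + nu = 0) ?powRr0 ?mul1r//; ring.
Qed.

Section bound.
Variable T : R.
Hypothesis T0 : 0 < T.

(** The cut-off at T makes w' integrable on the whole line, as Fubini's theorem below requires. *)
Let h : R -> R := derive1 w \_ `]0, T].

Let ih : mu.-integrable [set: R] (EFin \o h).
Proof.
rewrite /h -restrict_EFin; apply: (integrable_mkcond _ _).1 => //.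
exact: integrable_derive1.
Qed.

Let mh : measurable_fun [set: R] h.
Proof. by apply/measurable_EFinP; exact: measurable_int ih. Qed.

Let wh (t : R) : 0 < t <= T -> \int[mu]_r (powker 1 (t - r) * h r) = w t.
Proof.
move=> /andP[t0 tT]; rewrite -(integral_derive1_oc t0 dw w0); last exact: integrable_derive1.
rewrite -Rintegral_itv_bndo_bndc; last first.
  by apply: integrableS (integrable_derive1 t0) => //; apply: subset_itvl; rewrite bnd_simp.
rewrite [RHS]Rintegral_mkcond; apply: eq_Rintegral => r _.
rewrite /h !patchE; have [|/negP r0] := boolP (r \in `]0, t[%classic).
  move; rewrite inE/= in_itv/= => /andP[r0 rt].
  have rT : r <= T by rewrite (le_trans (ltW rt)).
  rewrite !mem_set/= ?in_itv/= ?r0 ?rt ?rT//.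
  by rewrite powker_gt0E ?subr_gt0// subrr powRr0 mul1r.
have [tr|rt] := leP t r; first by rewrite powker_le0E ?mul0r// subr_le0.
rewrite memNset ?mulr0//= in_itv/= => /andP[rr _].
by apply: r0; rewrite inE/= in_itv/= rr.
Qed.

Let khE (s : R) : s <= T ->
  (fun r => powker (1 - nu) (s - r) * h r) = caputo_kernel nu w s.
Proof.
move=> sT; apply/funext => r; rewrite /caputo_kernel /h patchE.
have [|/negP r0] := boolP (r \in `]0, T]%classic).
  by rewrite inE/= in_itv/= => /andP[-> _].
rewrite mulr0; case: ifPn => // r1.
rewrite powker_le0E ?mul0r// subr_le0 leNgt; apply/negP => rs; apply: r0.
by rewrite inE/= in_itv/= r1 (le_trans (ltW rs)).
Qed.

Let kh (s : R) : 0 < s <= T ->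
  (\int[mu]_r (powker (1 - nu) (s - r) * h r)%:E = (- (Gamma (1 - nu) * lambda * w s))%:E)%E.
Proof.
move=> /andP[s0 sT].
have := wE s0; rewrite caputoE ?nu0//; last exact: iw.
move=> /(congr1 (fun z => Gamma (1 - nu) * z)).
rewrite mulrA mulfV ?mul1r ?gt_eqF ?Gamma_gt0// => e.
rewrite -[LHS]fineK; last first.
  by apply: integrable_fin_num => //; have := iw s0; rewrite -khE.
congr EFin; rewrite -[LHS]/(\int[mu]_r (powker (1 - nu) (s - r) * h r)).
by rewrite khE// e; ring.
Qed.

(** Fubini for [F] expresses that the Riemann-Liouville integrals of orders nu and 1 - nu compose to
    order 1. Integrating in the first variable gives B(nu, 1 - nu) w t by [kkE] and [wh];
    integrating in the second brings in the equation through [kh]. *)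
Let F (t : R) (p : R * R) : R :=
  powker nu (t - p.1) * powker (1 - nu) (p.1 - p.2) * h p.2.

Let c := Gamma nu * Gamma (1 - nu).

Let c0 : 0 < c. Proof. by rewrite mulr_gt0 ?Gamma_gt0. Qed.

Let kkE (t r : R) :
  (\int[mu]_s (powker nu (t - s) * powker (1 - nu) (s - r))%:E =
   (c * powker 1 (t - r))%:E)%E.
Proof. by rewrite powker_conv_shift// (_ : nu + (1 - nu) = 1) ?Gamma1 ?divr1//; ring. Qed.

Let mkk (t r : R) :
  measurable_fun [set: R] (fun s => (powker nu (t - s) * powker (1 - nu) (s - r))%:E).
Proof.
apply/measurable_EFinP; apply: measurable_funM.
  by apply: (measurableT_comp (measurable_powker nu)); exact: measurable_funB.
by apply: (measurableT_comp (measurable_powker _)); exact: measurable_funB.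
Qed.

Let ikk (t r : R) : mu.-integrable [set: R]
  (fun s => (powker nu (t - s) * powker (1 - nu) (s - r))%:E).
Proof.
apply/integrableP; split; first exact: mkk.
under eq_integral do rewrite gee0_abs ?lee_fin ?mulr_ge0 ?powker_ge0//.
by rewrite kkE ltry.
Qed.

Let powker1_le1 (s : R) : powker 1 s <= 1.
Proof. by rewrite /powker subrr powRr0; case: ifP. Qed.

Let iF (t : R) : (mu \x mu)%E.-integrable setT (EFin \o F t).
Proof.
have mF : measurable_fun setT (EFin \o F t).
  apply/measurable_EFinP; apply: measurable_funM; last exact: measurableT_comp.
  apply: measurable_funM.
    by apply: (measurableT_comp (measurable_powker nu)); exact: measurable_funB.
  by apply: (measurableT_comp (measurable_powker _)); exact: measurable_funB.
have maF : measurable_fun setT (abse \o (EFin \o F t)) by exact: measurableT_comp.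
apply: (integrable21ltyP mu mu mF).2.
apply: (@le_lt_trans _ _ (\int[mu]_r (c%:E * `|(h r)%:E|))%E).
  apply: ge0_le_integral => //.
  - by move=> r _; apply: integral_ge0.
  - exact: (@measurable_fun_fubini_tonelli_G _ _ _ _ _ mu _ maF (fun p => abse_ge0 _)).
  - apply: measurable_funeM; apply: measurableT_comp => //.
    exact/measurable_EFinP.
  move=> r _; under eq_integral.
    move=> s _; rewrite /F/= normrM ger0_norm ?mulr_ge0 ?powker_ge0// EFinM.
    over.
  rewrite ge0_integralZr//; last 2 first.
  - exact: mkk.
  - by move=> s _; rewrite lee_fin mulr_ge0 ?powker_ge0.
  by rewrite kkE -!EFinM lee_fin ler_wpM2r// ler_piMr// ltW// c0.
rewrite ge0_integralZl//.
- have /integrableP[_ hfin] := ih.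
  by rewrite lte_mul_pinfty// lee_fin ltW.
- by apply: measurableT_comp => //; exact/measurable_EFinP.
- by rewrite lee_fin ltW.
Qed.

Let i1h (t : R) : mu.-integrable [set: R] (EFin \o (fun r => powker 1 (t - r) * h r)).
Proof.
apply: le_integrable ih => //.
  apply/measurable_EFinP; apply: measurable_funM => //.
  by apply: (measurableT_comp (measurable_powker _)); exact: measurable_funB.
by move=> r _ /=; rewrite lee_fin normrM ger0_norm ?powker_ge0// ler_piMl.
Qed.

(** By Fubini, c w(t) is - lambda Gamma (1 - nu) times the convolution of t^(nu - 1) with w. Against
    the weight this convolution yields C^(- nu) Gamma nu; the Gamma factors cancel with c, and
    lambda C^(- nu) = 1/2 remains. *)
Lemma weighted_bound_step (C M t : R) : 0 < C -> C `^ (- nu) = (2 * lambda)^-1 ->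
  0 <= M -> (forall s, 0 < s <= T -> `|w s| <= M * expR (C * s)) ->
  0 < t <= T -> `|w t| <= M / 2 * expR (C * t).
Proof.
move=> C0 Cnu M0 wM tT; have /andP[t0 tleT] := tT.
have rhs : (\int[mu]_r \int[mu]_s (EFin \o F t) (s, r) = (c * w t)%:E)%E.
  transitivity (\int[mu]_r (c%:E * (powker 1 (t - r) * h r)%:E))%E.
    apply: eq_integral => r _; rewrite /F/=.
    under eq_integral do rewrite EFinM.
    by rewrite integralZr// kkE -!EFinM mulrA.
  rewrite integralZl; [|by []|exact: i1h].
  rewrite -(wh tT) [RHS]EFinM; congr (_ * _)%E; rewrite fineK//.
  exact: integrable_fin_num (i1h t).
have lhs := etrans (@Fubini _ _ _ _ _ mu mu _ (iF t)) rhs.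
have mG := @measurable_fubini_F _ _ _ _ _ mu mu _ (iF t).
have key : (`|(c * w t)%:E| <= \int[mu]_s ((lambda * Gamma (1 - nu) * M)%:E *
    (powker nu (t - s) * expR (C * s))%:E))%E.
  rewrite -lhs; apply: le_trans (le_abse_integral mu measurableT mG) _.
  apply: ge0_le_integral => //.
  - exact: measurableT_comp.
  - apply: measurable_funeM; apply/measurable_EFinP; apply: measurable_funM.
      by apply: (measurableT_comp (measurable_powker nu)); exact: measurable_funB.
    by apply: measurableT_comp => //; exact: measurable_funM.
  move=> s _; rewrite /fubini_F /F/=.
  have B0 : (0 <= (lambda * Gamma (1 - nu) * M)%:E * (powker nu (t - s) * expR (C * s))%:E)%E.
    by rewrite -EFinM lee_fin !mulr_ge0 ?Gamma_ge0 ?powker_ge0 ?expR_ge0// ltW.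
  (* Outside 0 < s < t the inner integral is 0, since h vanishes on r <= 0 and the outer kernel on s
     >= t; in between, [kh] evaluates it. *)
  have [s0|s0] := leP s 0.
    rewrite integral0_eq ?abse0// => r _; rewrite /h patchE.
    case: ifPn => [|_]; last by rewrite mulr0.
    rewrite inE/= in_itv/= => /andP[r0 _].
    by rewrite (@powker_le0E _ (1 - nu)) ?mulr0 ?mul0r// subr_le0 (le_trans s0)// ltW.
  have [ts|st] := leP t s.
    by rewrite integral0_eq ?abse0// => r _; rewrite powker_le0E ?mul0r// subr_le0.
  have sT : 0 < s <= T by rewrite s0 (le_trans (ltW st)).
  under eq_integral do rewrite -mulrA EFinM.
  rewrite integralZl//; last first.
    by have := iw s0; rewrite -khE//; case/andP: sT.
  rewrite kh// -!EFinM lee_fin normrM ger0_norm ?powker_ge0//.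
  rewrite normrN normrM ger0_norm ?mulr_ge0 ?Gamma_ge0 ?(ltW lambda0)//.
  rewrite [leRHS]mulrCA ler_wpM2l ?powker_ge0// (mulrC lambda) -[leRHS]mulrA.
  by rewrite ler_wpM2l ?mulr_ge0 ?Gamma_ge0 ?(ltW lambda0)// wM.
move: key; rewrite ge0_integralZl_EFin//; last 3 first.
- by move=> s _; rewrite lee_fin mulr_ge0 ?powker_ge0 ?expR_ge0.
- apply/measurable_EFinP; apply: measurable_funM.
    by apply: (measurableT_comp (measurable_powker nu)); exact: measurable_funB.
  by apply: measurableT_comp => //; exact: measurable_funM.
- by rewrite !mulr_ge0 ?Gamma_ge0// ltW.
rewrite integral_powker_expR// -EFinM lee_fin normrM (gtr0_norm c0) Cnu.
move=> hle; rewrite -(ler_pM2l c0); apply: le_trans hle _.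
rewrite /c le_eqVlt; apply/orP; left.
by apply/eqP; field; rewrite gt_eqF.
Qed.

Lemma homogeneous_bound (t : R) : 0 < t <= T ->
  `|w t| <= fine (\int[mu]_r `|(h r)%:E|)%E.
Proof.
move=> tT; rewrite -(wh tT).
apply: le_trans (le_normr_Rintegral measurableT (i1h t)) _.
have ih' : mu.-integrable [set: R] (EFin \o (fun r => `|h r|)) by exact: integrable_norm.
apply: le_Rintegral => //.
  exact: (integrable_norm (i1h t)).
by move=> r _; rewrite normrM ger0_norm ?powker_ge0// ler_piMl.
Qed.

End bound.

Lemma homogeneous_eq0 (t : R) : 0 < t -> w t = 0.
Proof.
move=> t0.
pose C := (2 * lambda) `^ nu^-1.
have l0 : 0 < 2 * lambda by rewrite mulr_gt0.
have C0 : 0 < C by rewrite powR_gt0.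
have Cnu : C `^ (- nu) = (2 * lambda)^-1.
  by rewrite -powRrM mulrN mulVf ?gt_eqF// powR_inv1// ltW.
set M := fine (\int[mu]_r `|((derive1 w \_ `]0, t]) r)%:E|)%E.
have M0 : 0 <= M by apply: fine_ge0; apply: integral_ge0.
(* The halving is iterated on one interval with C fixed; the case n = 0 uses exp (C s) >= 1. *)
have bd n : forall s, 0 < s <= t -> `|w s| <= M / 2 ^+ n * expR (C * s).
  elim: n => [s st|n IH s st].
    rewrite expr0 divr1; apply: le_trans (homogeneous_bound t0 st) _.
    rewrite ler_peMr// -expR0 ler_expR mulr_ge0 ?(ltW C0)//.
    by case/andP: st => /ltW.
  rewrite exprSr invfM mulrA.
  by apply: (weighted_bound_step t0) => //; rewrite divr_ge0 ?exprn_ge0.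
have cv : M / 2 ^+ n * expR (C * t) @[n --> \oo] --> M * 0 * expR (C * t).
  apply: cvgM; last exact: cvg_cst.
  apply: cvgM; first exact: cvg_cst.
  under eq_fun do rewrite -exprVn.
  by apply: cvg_expr; rewrite ger0_norm ?invr_ge0// invf_lt1// ltr1n.
rewrite mulr0 mul0r in cv.
have tt : 0 < t <= t by rewrite t0 lexx.
apply/eqP; rewrite -normr_le0 -(cvg_lim _ cv)//.
by apply: limr_ge; [exact: cvgP cv|exact: nearW (fun n => bd n t tt)].
Qed.

End uniqueness.

(** * The fractional Poisson process *)

Section solution.
Context {R : realType}.
Local Notation mu := (@lebesgue_measure R).

Lemma caputo_kernelB (nu : R) (u v : R -> R) (t : R) :
  (forall s, 0 < s -> derivable u s 1) -> (forall s, 0 < s -> derivable v s 1) ->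
  caputo_kernel nu (u \- v) t = caputo_kernel nu u t \- caputo_kernel nu v t.
Proof.
move=> du dv; apply/funext => s; rewrite /caputo_kernel /=.
case: ifPn => [s0|_]; last by rewrite subr0.
by rewrite -mulrBr !derive1E deriveB//; [exact: du|exact: dv].
Qed.

(** The source [f] will be lambda p_(k-1), or 0 when k = 0; it cancels in u - v. *)
Lemma fractional_eq_unique (lambda nu : R) (u v f : R -> R) :
  0 < lambda -> 0 < nu -> nu <= 1 ->
  caputo_derivable nu u -> caputo_derivable nu v ->
  (forall t, 0 < t -> caputo nu u t = - lambda * u t + f t) ->
  (forall t, 0 < t -> caputo nu v t = - lambda * v t + f t) ->
  u x @[x --> 0^'+] --> u 0 -> v x @[x --> 0^'+] --> v 0 -> u 0 = v 0 ->
  forall t, 0 < t -> u t = v t.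
Proof.
move=> l0 nu0 nu1; rewrite /caputo_derivable caputo_order1// => -[du iu] [dv iv].
move=> ue ve u0 v0 uv0 t t0.
have {}du s : 0 < s -> derivable u s 1 by exact: (du 0%N s isT).
have {}dv s : 0 < s -> derivable v s 1 by exact: (dv 0%N s isT).
apply/eqP; rewrite -subr_eq0; apply/eqP.
have dw s : 0 < s -> derivable (u \- v) s 1.
  by move=> s0; apply: derivableB; [exact: du|exact: dv].
have w0 : (u \- v) x @[x --> 0^'+] --> 0.
  by have := cvgB u0 v0; rewrite uv0 subrr; apply.
have [nult1|] := boolP (nu < 1).
  have nun1 : nu != 1%:R by rewrite lt_eqF.
  have ku s : 0 < s -> mu.-integrable [set: R] (EFin \o caputo_kernel nu u s).
    by move=> s0; apply: (caputo_integrableP _ _ nu0 nu1).1; exact: iu.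
  have kv s : 0 < s -> mu.-integrable [set: R] (EFin \o caputo_kernel nu v s).
    by move=> s0; apply: (caputo_integrableP _ _ nu0 nu1).1; exact: iv.
  have kw s : 0 < s -> mu.-integrable [set: R] (EFin \o caputo_kernel nu (u \- v) s).
    move=> s0; rewrite caputo_kernelB//.
    exact: (@integrableB _ _ _ mu setT measurableT _ _ (ku s s0) (kv s s0)).
  apply: (@homogeneous_eq0 _ lambda nu (u \- v)) => // s s0.
  have nu01 : 0 < nu < 1 by rewrite nu0.
  rewrite (caputoE nu01 (kw s s0)) caputo_kernelB// RintegralB//; [|exact: ku|exact: kv].
  transitivity (caputo nu u s - caputo nu v s); last by rewrite ue// ve//=; ring.
  by rewrite (caputoE nu01 (ku s s0)) (caputoE nu01 (kv s s0)) mulrBr.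
move=> nu1'; have nuE : nu = 1 by apply/eqP; rewrite eq_le nu1 leNgt nu1'.
apply: (@homogeneous_order1 _ lambda (u \- v)) => // s s0.
have := ve s s0; have := ue s s0.
rewrite /caputo caputo_order1//= nuE eqxx/= => ue' ve'.
rewrite derive1E deriveB//; [|exact: du|exact: dv].
by rewrite -!derive1E ue' ve'; ring.
Qed.

(* The sign is (-1)^(j - k), written without truncated subtraction. *)
Definition poisson_coef (lambda : R) (k j : nat) : R :=
  'C(j, k)%:R * (-1) ^+ (j + k) * lambda ^+ j.

Lemma bin_le_exp2 (n m : nat) : ('C(n, m) <= 2 ^ n)%N.
Proof.
elim: n m => [|n IH] [|m] //; first by rewrite bin0 expn_gt0.
by rewrite binS expnS mul2n -addnn leq_add.
Qed.

(** The factor 1 gives the bound the shape C K^j asked for by the series lemmas; the 2 in K comes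
    from C(j, k) <= 2^j. *)
Lemma poisson_coef_le (lambda : R) (k j : nat) : 0 < lambda ->
  `|poisson_coef lambda k j| <= 1 * (2 * lambda) ^+ j.
Proof.
move=> l0; rewrite mul1r /poisson_coef exprMn !normrM normrX normrN1 expr1n mulr1.
rewrite ger0_norm// ger0_norm ?exprn_ge0 ?(ltW l0)//.
by rewrite ler_wpM2r ?exprn_ge0 ?(ltW l0)// -natrX ler_nat bin_le_exp2.
Qed.

Lemma poisson_coef0S (lambda : R) (j : nat) :
  poisson_coef lambda 0 j.+1 = - lambda * poisson_coef lambda 0 j.
Proof. by rewrite /poisson_coef !bin0 !addn0 !exprS; ring. Qed.

Lemma poisson_coefSS (lambda : R) (k j : nat) :
  poisson_coef lambda k.+1 j.+1 =
  - lambda * poisson_coef lambda k.+1 j + lambda * poisson_coef lambda k j.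
Proof. by rewrite /poisson_coef binS natrD addSn addnS !exprS; ring. Qed.

Lemma poisson_coef_0 (lambda : R) (k : nat) :
  poisson_coef lambda k 0 = if k == 0%N then 1 else 0.
Proof.
by case: k => [|k]; rewrite /poisson_coef ?bin0 ?bin0n/= ?addn0 ?expr0 ?mulr1 ?mul0r.
Qed.

Lemma pochhammer_fact (k r : nat) :
  pochhammer (k.+1%:R : R) r * k`!%:R = (r + k)`!%:R.
Proof.
elim: r => [|r IH]; first by rewrite /pochhammer big_ord0 mul1r.
rewrite /pochhammer big_ord_recr /= -/(pochhammer _ _) mulrAC IH -natrD.
by rewrite -natrM [in RHS]addSn factS mulnC addSn (addnC k).
Qed.

Lemma ml_sum_lin (nu x y C K : R) (a b : R ^nat) (t : R) : 0 < nu -> 0 < K ->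
  (forall j, `|a j| <= C * K ^+ j) -> (forall j, `|b j| <= C * K ^+ j) ->
  ml_sum nu (fun j => x * a j + y * b j) t = x * ml_sum nu a t + y * ml_sum nu b t.
Proof.
move=> nu0 K0 aC bC; rewrite /ml_sum -psum_lin; last 2 first.
- exact: superexp_decay_Gamma nu0 K0 aC.
- exact: superexp_decay_Gamma nu0 K0 bC.
by congr (psum _ _); apply/funext => j; ring.
Qed.

Lemma fractional_Poisson_solution_ml_sum (lambda nu : R) :
  0 < lambda -> 0 < nu -> nu <= 1 ->
  fractional_Poisson_solution lambda nu (fun k => ml_sum nu (poisson_coef lambda k)).
Proof.
move=> l0 nu0 nu1 k.
have K0 : 0 < 2 * lambda by rewrite mulr_gt0.
have aC i := fun j => poisson_coef_le i j l0.
split.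
- exact: (caputo_derivable_ml_sum nu0 nu1 K0 (aC k)).
- move=> t t0; rewrite (caputo_ml_sum nu0 nu1 K0 (aC k))//.
  case: k => [|k] /=.
    (* A second summand with coefficient 0 lets [ml_sum_lin] serve here too. *)
    rewrite subr0 -[RHS]addr0 -[in RHS](mul0r (ml_sum nu (poisson_coef lambda 0) t)).
    rewrite -(ml_sum_lin _ _ _ nu0 K0 (aC 0) (aC 0)).
    by congr (ml_sum _ _ _); apply/funext => j; rewrite mul0r addr0 poisson_coef0S.
  rewrite (_ : _ * _ = - lambda * ml_sum nu (poisson_coef lambda k.+1) t +
     lambda * ml_sum nu (poisson_coef lambda k) t); last by ring.
  rewrite -(ml_sum_lin _ _ _ nu0 K0 (aC k.+1) (aC k)).
  by congr (ml_sum _ _ _); apply/funext => j; rewrite poisson_coefSS.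
- exact: (ml_sum_cvg0 nu0 K0 (aC k)).
- by rewrite ml_sum0// poisson_coef_0.
Qed.

(** As C(j, k) = 0 for j < k, the series starts at j = r + k, where C(r + k, k) = (k + 1)_r / r! and
    the sign (-1)^(r + 2 k) is (-1)^r. The common factor (lambda t^nu)^k is nonzero and can be
    divided out of the partial sums. *)
Lemma ml_sum_mittag_leffler (lambda nu : R) (k : nat) (t : R) :
  0 < lambda -> 0 < nu -> 0 < t ->
  ml_sum nu (poisson_coef lambda k) t = (lambda * t `^ nu) ^+ k *
     mittag_leffler nu (nu * k%:R + 1) k.+1%:R (- (lambda * t `^ nu)).
Proof.
move=> l0 nu0 t0.
have K0 : 0 < 2 * lambda by rewrite mulr_gt0.
set z := t `^ nu; have z0 : 0 < z by rewrite powR_gt0.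
have lz0 : (lambda * z) ^+ k != 0 by rewrite expf_neq0// gt_eqF// mulr_gt0.
pose c j := poisson_coef lambda k j / Gamma (nu * j%:R + 1).
have cc : cvgn (pseries c z).
  apply: superexp_decay_cvg.
  exact: superexp_decay_Gamma nu0 K0 (fun j => poisson_coef_le k j l0).
have E n : pseries c z (n + k)%N = (lambda * z) ^+ k *
  series (fun r : nat => pochhammer k.+1%:R r * (- (lambda * z)) ^+ r /
    (r`!%:R * Gamma (nu * r%:R + (nu * k%:R + 1)))) n.
  rewrite /pseries/series/= addnC (big_cat_nat (n := k)) ?leq_addr//=.
  rewrite [X in X + _]big_nat_cond big1 ?add0r; last first.
    move=> j; rewrite andbT => /andP[_ jk].
    by rewrite /c /poisson_coef bin_small// !mul0r.
  rewrite -{1}(add0n k) big_addn addKn mulr_sumr; apply: eq_bigr => r _.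
  have kf : (k`!%:R : R) != 0 by rewrite pnatr_eq0 -lt0n fact_gt0.
  have rf : (r`!%:R : R) != 0 by rewrite pnatr_eq0 -lt0n fact_gt0.
  have bE : 'C(r + k, k)%:R = pochhammer k.+1%:R r / r`!%:R :> R.
    apply: (mulIf kf); rewrite mulrAC pochhammer_fact.
    apply: (mulIf rf); rewrite divfK//.
    have := bin_fact (leq_addl r k); rewrite addnK => <-.
    by rewrite !natrM mulrA.
  have G0 : 0 < Gamma (nu * r%:R + (nu * k%:R + 1)).
    by apply: Gamma_gt0; rewrite addrA ltr_wpDl// addr_ge0// mulr_ge0// ltW.
  rewrite /c /poisson_coef bE natrD mulrDr -addrA.
  rewrite -addnA addnn exprD -mul2n exprM sqrrN !expr1n mulr1.
  rewrite (exprNn (lambda * z)) !exprMn !exprD; field.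
  by rewrite rf gt_eqF.
have cE : series (fun r : nat => pochhammer k.+1%:R r * (- (lambda * z)) ^+ r /
    (r`!%:R * Gamma (nu * r%:R + (nu * k%:R + 1)))) n @[n --> \oo] -->
    ((lambda * z) ^+ k)^-1 * limn (pseries c z).
  rewrite (_ : (fun n => _) = (fun n => ((lambda * z) ^+ k)^-1 * pseries c z (n + k)%N)).
    apply: cvgMl_tmp; rewrite (cvg_shiftn k (pseries c z) _); exact: cc.
  by apply/funext => n; rewrite E mulKf.
by rewrite /mittag_leffler (cvg_lim _ cE)// mulVKf.
Qed.

End solution.

Theorem theorem2p1 (R : realType) (lambda nu : R)
    (lambda_gt0 : 0 < lambda) (nu_gt0 : 0 < nu) (nu_le1 : nu <= 1) :
  (exists p : nat -> R -> R, fractional_Poisson_solution lambda nu p) /\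
  (forall p : nat -> R -> R, fractional_Poisson_solution lambda nu p ->
     forall (k : nat) (t : R), 0 < t ->
       p k t = (lambda * t `^ nu) ^+ k *
         mittag_leffler nu (nu * k%:R + 1) k.+1%:R (- (lambda * t `^ nu))).
Proof.
have qsol := fractional_Poisson_solution_ml_sum lambda_gt0 nu_gt0 nu_le1.
split; first by exists (fun k => ml_sum nu (poisson_coef lambda k)).
move=> p psol k t t0; rewrite -ml_sum_mittag_leffler//.
elim: k t t0 => [|k IH] t t0.
- have [dp ep cp p0] := psol 0; have [dq eq cq q0] := qsol 0.
  apply: (@fractional_eq_unique _ lambda nu _ _ (fun=> 0)) => //.
  + by move=> s s0; rewrite ep//= subr0 addr0.
  + by move=> s s0; rewrite eq//= subr0 addr0.
  + by rewrite p0 q0.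
- have [dp ep cp p0] := psol k.+1; have [dq eq cq q0] := qsol k.+1.
  apply: (@fractional_eq_unique _ lambda nu _ _
    (fun s => lambda * ml_sum nu (poisson_coef lambda k) s)) => //.
  + by move=> s s0; rewrite ep//= IH//; ring.
  + by move=> s s0; rewrite eq//=; ring.
  + by rewrite p0 q0.
Qed.
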